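(* Let $R$ be an SP-domain, and let $\mathcal{M}$ be its maximal space with the inverse topology, with Gleason cover $j:E_{\mathcal{M}}\to\mathcal{M}$. Let $\Psi:\mathrm{Inv}(R)\to\mathcal{C}_c(\mathcal{M},\mathbb{Z})$ be $I\mapsto\nu_I$ and $\psi:\mathcal{C}_c(\mathcal{M},\mathbb{Z})\to\mathcal{C}_c(E_{\mathcal{M}},\mathbb{Z})$ be $f\mapsto f\circ j$. Then $\Psi$ is an isomorphism and there is an isomorphism $\beta:\mathrm{Div}(R)\to\mathcal{C}_c(E_{\mathcal{M}},\mathbb{Z})$ such that $\beta|_{\mathrm{Inv}(R)}=\psi\circ\Psi$ (i.e., the square formed by the inclusion $\mathrm{Inv}(R)\subseteq\mathrm{Div}(R)$, $\Psi$, $\beta$ and $\psi$ commutes). In particular, $\mathrm{Div}(R)\simeq\mathcal{C}_c(E_{\mathcal{M}},\mathbb{Z})$ and $\mathrm{Div}(R)/\mathrm{Inv}(R)$ are free abelian groups.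
   Context: An SP-domain is an integral domain in which every proper ideal is a finite product of radical ideals; it is an almost Dedekind domain ($R_M$ is a DVR for every maximal $M$), with valuation $v_M$. For a nonzero fractional ideal $I$, $\nu_I:\mathrm{Max}(R)\to\mathbb{Z}$, $\nu_I(M)=\inf\{v_M(i)\mid i\in I\setminus\{0\}\}$. $\mathcal{M}$ is $\mathrm{Max}(R)$ with the inverse topology (restriction of the coarsest topology on $\mathrm{Spec}(R)$ in which Zariski-open Zariski-compact sets are closed; equal to the constructible topology on $\mathrm{Max}(R)$). $\mathrm{Inv}(R)$ is the group of invertible fractional ideals; $\mathrm{Div}(R)$ is the set of divisorial fractional ideals ($(R:(R:I))=I$), a group under $I\ast J=(R:(R:IJ))$, containing $\mathrm{Inv}(R)$ as a subgroup. $\mathcal{C}_c(X,\mathbb{Z})$ is the group of continuous compactly supported functions $X\to\mathbb{Z}$ ($\mathbb{Z}$ discrete). For a regular Hausdorff space $X$, the Gleason cover is the minimal extremally disconnected space $E_X$ (closure of every open set is open) with a perfect (closed, continuous, with compact fibres) surjection $j:E_X\to X$. *)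

(* Defs.v *)
From HB Require Import structures.
From mathcomp Require Import all_boot all_order all_algebra.
From mathcomp Require Import all_classical all_reals all_analysis.
From Stdlib Require List.
Set Implicit Arguments. Unset Strict Implicit. Unset Printing Implicit Defensive.
Import Order.TTheory GRing.Theory Num.Theory.
Local Open Scope classical_set_scope.
Local Open Scope ring_scope.

Definition iprod (T : comNzRingType) (A B : set T) : set T :=
  [set x | exists s : seq (T * T),
      (forall p, List.In p s -> A p.1 /\ B p.2) /\ x = \sum_(p <- s) (p.1 * p.2)].

Definition is_ideal (T : comNzRingType) (I : set T) : Prop :=
  [/\ I 0, (forall x y, I x -> I y -> I (x + y)) & (forall r x, I x -> I (r * x))].

Definition is_radical (T : comNzRingType) (I : set T) : Prop :=
  forall x (n : nat), I (x ^+ n.+1) -> I x.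

Definition is_prime_ideal (T : comNzRingType) (P : set T) : Prop :=
  [/\ is_ideal P, ~ P 1 & forall a b, P (a * b) -> P a \/ P b].

Definition is_maximal_ideal (T : comNzRingType) (M : set T) : Prop :=
  [/\ is_ideal M, ~ M 1 &
      forall J, is_ideal J -> M `<=` J -> J = M \/ J = setT].

Definition SP_domain (R : idomainType) : Prop :=
  forall I : set R, is_ideal I -> I <> setT ->
    exists s : seq (set R),
      (forall J, List.In J s -> is_ideal J /\ is_radical J) /\
      foldr (@iprod R) setT s = I.

Definition not_field (R : idomainType) : Prop :=
  exists x : R, x != 0 /\ ~~ (x \is a GRing.unit).

Section Frac.
Variable R : idomainType.
Local Notation K := {fraction R}.

Definition Rset : set K := [set x | exists a : R, x = tofrac a].

Definition is_frac_ideal (I : set K) : Prop :=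
  [/\ I 0, (forall x y, I x -> I y -> I (x + y)),
      (forall (r : R) x, I x -> I (tofrac r * x)),
      (exists d : R, d != 0 /\ forall x, I x -> Rset (tofrac d * x)) &
      (exists x, I x /\ x != 0)].

Definition colon (A B : set K) : set K := [set x | forall b, B b -> A (x * b)].

Definition invertible (I : set K) : Prop :=
  is_frac_ideal I /\ iprod I (colon Rset I) = Rset.

Definition divisorial (I : set K) : Prop :=
  is_frac_ideal I /\ colon Rset (colon Rset I) = I.

Definition dstar (I J : set K) : set K := colon Rset (colon Rset (iprod I J)).

Definition loc (M : set R) : set K :=
  [set x | exists a s : R, ~ M s /\ x = tofrac a / tofrac s].

Definition is_valuation_of (M : set R) (v : K -> int) : Prop :=
  [/\ (forall x y, x != 0 -> y != 0 -> v (x * y) = v x + v y),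
      (forall x y, x != 0 -> y != 0 -> x + y != 0 ->
          v x <= v (x + y) \/ v y <= v (x + y)),
      (exists t, t != 0 /\ v t = 1) &
      (forall x, x != 0 -> (loc M x <-> 0 <= v x))].

(** v_M (the DVR valuation of R_M; unique when it exists) *)
Definition vM (M : set R) : K -> int :=
  match pselect (exists v, is_valuation_of M v) with
  | left h => projT1 (cid h)
  | right _ => fun _ => 0
  end.

(** nu_I(M) = inf { v_M(i) | i in I \ 0 } (a minimum in Z) *)
Definition nu (I : set K) (M : set R) : int :=
  xget 0 [set n : int | (exists i, [/\ I i, i != 0 & vM M i = n]) /\
                        (forall i, I i -> i != 0 -> n <= vM M i)].

End Frac.

Definition zD (R : comNzRingType) (S : set R) : set (set R) :=
  [set P | is_prime_ideal P /\ ~ (S `<=` P)].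

Definition zopen (R : comNzRingType) (U : set (set R)) : Prop :=
  exists S, U = zD S.

Definition zcompact (R : comNzRingType) (U : set (set R)) : Prop :=
  forall (I : Type) (F : I -> set R),
    U `<=` [set P | exists i, zD (F i) P] ->
    exists s : seq I, U `<=` [set P | exists i, List.In i s /\ zD (F i) P].

Section MaxSpace.
Variable R : idomainType.

Definition MaxT : Type := {M : set R | is_maximal_ideal M}.

HB.instance Definition _ := gen_eqMixin MaxT.
HB.instance Definition _ := gen_choiceMixin MaxT.

(** subbase of the inverse topology restricted to Max(R): complements of
    Zariski-open Zariski-compact subsets of Spec(R), intersected with Max(R) *)
Definition inv_subbase : set (set MaxT) :=
  [set A | exists U : set (set R), [/\ zopen U, zcompact U &
             A = [set M : MaxT | ~ U (sval M)]]].

HB.instance Definition _ :=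
  isSubBaseTopological.Build MaxT inv_subbase id.

Definition nuM (I : set {fraction R}) : MaxT -> int := fun M => nu I (sval M).

End MaxSpace.

(** continuous compactly supported functions X -> Z (Z discrete) *)
Definition Cc (X : topologicalType) (f : X -> int) : Prop :=
  (forall A : set int, open (f @^-1` A)) /\
  compact (closure [set x | f x != 0]).

(** (E, j) is the Gleason cover of X: E Hausdorff extremally disconnected,
    j a perfect surjection which is irreducible (minimality). *)
Definition gleason_cover (X E : topologicalType) (j : E -> X) : Prop :=
  [/\ hausdorff_space E,
      (forall U : set E, open U -> open (closure U)),
      continuous j,
      (forall C : set E, closed C -> closed (j @` C)) &
      (forall x : X, compact (j @^-1` [set x]))] /\
  (forall x : X, exists e, j e = x) /\
  (forall C : set E, closed C -> j @` C = setT -> C = setT).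

(* Free abelian groups (group given as a subset S of G with op,e,inv)  *)

Section Free.
Variables (G : Type) (op : G -> G -> G) (e : G) (inv : G -> G).

Definition zpow (x : G) (n : int) : G :=
  match n with
  | Posz k => iter k (op x) e
  | Negz k => iter k.+1 (op (inv x)) e
  end.

Definition comb (bs : seq G) (ns : seq int) : G :=
  foldr (fun p acc => op (zpow p.1 p.2) acc) e (zip bs ns).

(** the quotient group S/H is free abelian: there is B in S whose classes
    generate S/H and are Z-independent in S/H *)
Definition free_abelian_mod (S H : set G) : Prop :=
  exists B : set G, B `<=` S /\
    (forall x, S x -> exists bs ns h,
        [/\ H h, (forall b, List.In b bs -> B b) & x = op h (comb bs ns)]) /\
    (forall bs ns, List.NoDup bs -> size ns = size bs ->
        (forall b, List.In b bs -> B b) -> H (comb bs ns) ->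
        forall n, List.In n ns -> n = 0).

Definition free_abelian (S : set G) : Prop := free_abelian_mod S [set e].

End Free.

(* Main.v *)
(** In an SP-domain each local ring at a maximal ideal [M] is a discrete valuation
    ring: if [x] lies in a prime [Q] but not in [Q^2], then factoring [(x, z^2)] into
    radical ideals puts every [z] of [Q] in [xR] locally, and a prime minimal over
    [P + zR] cannot be idempotent.  The radical factors of [aR] are invertible, so
    [M |-> v_M(a)] is locally constant with compact support, and together with an
    approximation argument this identifies fractional ideals with suitable integer
    functions on the maximal spectrum and invertible ideals with [C_c].

    For a fractional ideal [I] the function [nu_I] is locally constant on a dense open
    set; composed with the irreducible map [j] it extends uniquely to a locally
    constant function on the extremally disconnected cover.  This extension turns
    products into sums, and [(R : I)] into the opposite, hence it only depends on the
    divisorial closure, which it determines.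

    Freeness is Noebeling's theorem, in the relative form of Bergman's proof: well-order
    the idempotents, those of the subring first, and adjoin them one at a time.  With
    [S] the ring generated by the earlier ones and [1], the quotient contributed by an
    idempotent [e] is [S / {b | e b already present}], a ring generated by fewer
    idempotents, which is free by induction. *)

Require Import Defs.
From HB Require Import structures.
From mathcomp Require Import all_boot all_order all_algebra.
From mathcomp Require Import all_classical all_reals all_analysis.
From mathcomp Require Import ring zify.
From mathcomp Require wochoice.
From Stdlib Require List.
Set Implicit Arguments. Unset Strict Implicit. Unset Printing Implicit Defensive.
Import Order.TTheory GRing.Theory Num.Theory.
Local Open Scope classical_set_scope.
Local Open Scope ring_scope.

(** * Ideals *)

Section IdealProducts.
Variable T : comNzRingType.
Implicit Types (A B C I J M P Q : set T) (x y z a b c u w : T).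

(** The local rings are never formed: a statement about R_Q becomes one about R with a multiplier
    outside [Q], and [sat Q I] is the contraction of the extension of [I] to R_Q. Dimension one is
    not known beforehand: a uniformizer is first available only at a prime minimal over an element,
    and the maximality of that prime comes from running the same argument once more above it.

    For a general [I] the function [nuM I] is only semicontinuous: near [M0] it is at most its value
    at [M0]. Hence [(R : I)] is seen to have the opposite values only where [nuM I] is locally
    constant. Conversely, a function [g] on the cover is realized by prescribing its fibrewise
    maximum as values; this prescription is attained wherever the nearby fibres all carry one value
    of [g].

    For the quotient by the invertible ideals, the subring must be described in a way that survives
    pullback along [j]: closure under sums and under left composition with maps fixing 0. Such a
    group need not have a unit, so constants are adjoined to the coefficients only and split off as
    a separate cyclic step. *)

Lemma iprod_mem A B a b : A a -> B b -> iprod A B (a * b).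
Proof.
move=> Aa Bb; exists [:: (a, b)]; split; last by rewrite big_seq1.
by move=> p [<-|[]].
Qed.

Lemma iprod_sub A B C : C 0 -> (forall x y, C x -> C y -> C (x + y)) ->
  (forall a b, A a -> B b -> C (a * b)) -> iprod A B `<=` C.
Proof.
move=> C0 CD CM _ [s [sP ->]]; elim: s sP => [|p s IH] sP.
  by rewrite big_nil.
rewrite big_cons; apply: CD.
  by have [|Ap Bp] := sP p; [left|exact: CM].
by apply: IH => q qs; apply: sP; right.
Qed.

Lemma iprod0 A B : iprod A B 0.
Proof. by exists [::]; split=> //; rewrite big_nil. Qed.

Lemma iprodD A B x y : iprod A B x -> iprod A B y -> iprod A B (x + y).
Proof.
move=> [s [sP ->]] [t [tP ->]]; exists (s ++ t); split; last by rewrite big_cat.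
by move=> p ps; have [/sP|/tP] := List.in_app_or _ _ _ ps.
Qed.

Lemma iprod_ideal A B : is_ideal A -> is_ideal (iprod A B).
Proof.
move=> [A0 AD AM]; split; [exact: iprod0|exact: iprodD|move=> r x ABx].
move: x ABx; apply: (@iprod_sub _ _ [set x | iprod A B (r * x)]) => /=.
- by rewrite mulr0; exact: iprod0.
- by move=> x y ? ?; rewrite mulrDr; exact: iprodD.
- by move=> a b Aa Bb; rewrite mulrA; apply: iprod_mem => //; exact: AM.
Qed.

Lemma iprodS A A' B B' : A `<=` A' -> B `<=` B' -> iprod A B `<=` iprod A' B'.
Proof.
move=> sA sB; apply: iprod_sub; [exact: iprod0|exact: iprodD|].
by move=> a b /sA ? /sB ?; exact: iprod_mem.
Qed.

Lemma iprod_subl A B : is_ideal A -> iprod A B `<=` A.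
Proof.
move=> [A0 AD AM]; apply: iprod_sub => // a b Aa _.
by rewrite mulrC; exact: AM.
Qed.

Lemma iprod_subr A B : is_ideal B -> iprod A B `<=` B.
Proof. by move=> [B0 BD BM]; apply: iprod_sub => // a b _; exact: BM. Qed.

Lemma iprodCA_sub A B C : iprod A (iprod B C) `<=` iprod B (iprod A C).
Proof.
apply: iprod_sub; [exact: iprod0|exact: iprodD|move=> a w Aa BCw].
move: w BCw; apply: (@iprod_sub _ _ [set w | iprod B (iprod A C) (a * w)]) => /=.
- by rewrite mulr0; exact: iprod0.
- by move=> x y ? ?; rewrite mulrDr; exact: iprodD.
- by move=> b c Bb Cc; rewrite mulrCA; do 2 apply: iprod_mem => //.
Qed.

Lemma setT_ideal : is_ideal [set: T].
Proof. by []. Qed.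

Lemma ideal_setT I : is_ideal I -> I 1 -> I = setT.
Proof.
by move=> [_ _ IM] I1; apply/seteqP; split=> // x _; rewrite -[x]mulr1; exact: IM.
Qed.

Definition pideal x : set T := [set y | exists r, y = r * x].

Lemma pideal_ideal x : is_ideal (pideal x).
Proof.
split; first by exists 0; rewrite mul0r.
- by move=> _ _ [r ->] [s ->]; exists (r + s); rewrite mulrDl.
- by move=> t _ [r ->]; exists (t * r); rewrite mulrA.
Qed.

Lemma pidealx x : pideal x x.
Proof. by exists 1; rewrite mul1r. Qed.

Lemma pideal_sub I x : is_ideal I -> I x -> pideal x `<=` I.
Proof. by move=> [_ _ IM] Ix _ [r ->]; exact: IM. Qed.

Definition isum I J : set T := [set y | exists a b, [/\ I a, J b & y = a + b]].

Lemma isum_ideal I J : is_ideal I -> is_ideal J -> is_ideal (isum I J).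
Proof.
move=> [I0 ID IM] [J0 JD JM]; split; first by exists 0, 0; rewrite addr0.
- move=> _ _ [a [b [? ? ->]]] [a' [b' [? ? ->]]].
  by exists (a + a'), (b + b'); rewrite addrACA; split; [exact: ID|exact: JD|].
- by move=> r _ [a [b [? ? ->]]]; exists (r * a), (r * b); rewrite mulrDr; split;
    [exact: IM|exact: JM|].
Qed.

Lemma isuml I J : J 0 -> I `<=` isum I J.
Proof. by move=> J0 x Ix; exists x, 0; rewrite addr0. Qed.

Lemma isumr I J : I 0 -> J `<=` isum I J.
Proof. by move=> I0 x Jx; exists 0, x; rewrite add0r. Qed.

Definition prodI (s : seq (set T)) : set T := foldr (@iprod T) setT s.

Lemma prodI_ideal s : (forall J, List.In J s -> is_ideal J) -> is_ideal (prodI s).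
Proof.
case: s => [|J s] sI; first exact: setT_ideal.
by apply: iprod_ideal; apply: sI; left.
Qed.

Lemma prodI_sub s J : (forall J, List.In J s -> is_ideal J) -> List.In J s ->
  prodI s `<=` J.
Proof.
elim: s => [//|J' s IH] sI /= [eJ|Js].
  by rewrite -eJ; apply: iprod_subl; apply: sI; left.
apply: subset_trans (IH _ Js); last by move=> ? ?; apply: sI; right.
by apply: iprod_subr; apply: prodI_ideal => ? ?; apply: sI; right.
Qed.

(** When the product is a nonzero principal ideal, this cofactor is what makes each radical factor
    [J] invertible. *)
Lemma prodI_factor s J : (forall J, List.In J s -> is_ideal J) -> List.In J s ->
  exists B, iprod J B = prodI s.
Proof.
elim: s => [//|J' s IH] sI /= [->|Js]; first by exists (prodI s).
have [B <-] := IH (fun K Ks => sI K (or_intror Ks)) Js.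
by exists (iprod J' B); apply/seteqP; split; exact: iprodCA_sub.
Qed.

Lemma primeM Q a b : is_prime_ideal Q -> ~ Q a -> ~ Q b -> ~ Q (a * b).
Proof. by move=> [_ _ QP] Qa Qb /QP[]. Qed.

Lemma primeX Q a n : is_prime_ideal Q -> ~ Q a -> ~ Q (a ^+ n).
Proof.
move=> pQ Qa; elim: n => [|n IH]; first by rewrite expr0; case: pQ.
by rewrite exprS; exact: primeM.
Qed.

Lemma prime_prodI Q s : is_prime_ideal Q ->
  (forall J, List.In J s -> is_ideal J) -> prodI s `<=` Q ->
  exists J, List.In J s /\ J `<=` Q.
Proof.
move=> pQ; elim: s => [|J s IH] sI /= sQ; first by case: pQ => _ Q1 _; case: Q1; exact: sQ.
have [JQ|/nonsubset[a [Ja Qa]]] := pselect (J `<=` Q); first by exists J; split; [left|].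
have [||J' [J's J'Q]] := IH.
- by move=> ? ?; apply: sI; right.
- by move=> b sb; have /sQ := iprod_mem Ja sb; case: pQ => _ _ QP /QP[].
- by exists J'; split; [right|].
Qed.

(** The contraction to the ring of the extension of [I] to the localization at [Q]. *)
Definition sat Q I : set T := [set w | exists c, ~ Q c /\ I (c * w)].

Lemma sat_ideal Q I : is_prime_ideal Q -> is_ideal I -> is_ideal (sat Q I).
Proof.
move=> pQ [I0 ID IM]; split.
- by exists 1; rewrite mulr0; case: pQ.
- move=> x y [c [Qc Ic]] [d [Qd Id]]; exists (c * d); split; first exact: primeM.
  rewrite mulrDr; apply: ID; first by rewrite mulrAC [_ * d]mulrC; exact: IM.
  by rewrite -mulrA; exact: IM.
- move=> r x [c [Qc Ic]]; exists c; split => //.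
  by rewrite mulrCA; exact: IM.
Qed.

Lemma sat_sub Q I : is_prime_ideal Q -> I `<=` sat Q I.
Proof. by move=> [_ Q1 _] x Ix; exists 1; rewrite mul1r. Qed.

Lemma satK Q I : is_prime_ideal Q -> sat Q (sat Q I) `<=` sat Q I.
Proof.
move=> pQ x [c [Qc [d [Qd Id]]]]; exists (d * c); split; first exact: primeM.
by rewrite -mulrA.
Qed.

(** The cases are: no factor inside [Q], one, or at least two. Factors not inside [Q] become trivial
    after localization, so a lone factor [J] inside [Q] agrees there with the whole product. *)
Lemma prodI_trichotomy Q s : is_prime_ideal Q ->
  (forall J, List.In J s -> is_ideal J) ->
  [\/ exists c, ~ Q c /\ prodI s c,
      exists J, [/\ List.In J s, J `<=` Q & J `<=` sat Q (prodI s)] |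
      prodI s `<=` iprod Q Q].
Proof.
move=> pQ; have [iQ Q1 _] := pQ; elim: s => [|J s IH] sI /=.
  by apply: Or31; exists 1.
have sI' K : List.In K s -> is_ideal K by move=> ?; apply: sI; right.
have iJ : is_ideal J by apply: sI; left.
have [JQ|/nonsubset[a [Ja Qa]]] := pselect (J `<=` Q).
  have [[c [Qc sc]]|[K [Ks KQ _]]|sQQ] := IH sI'.
  - apply: Or32; exists J; split=> //; first by left.
    by move=> y Jy; exists c; split=> //; rewrite mulrC; exact: iprod_mem.
  - by apply: Or33; apply: iprodS => //; apply: subset_trans KQ; exact: prodI_sub.
  - apply: Or33; apply: iprodS => //; apply: (subset_trans sQQ).
    exact: iprod_subl.
have [[c [Qc sc]]|[K [Ks KQ Ksat]]|sQQ] := IH sI'.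
- by apply: Or31; exists (a * c); split; [exact: primeM|exact: iprod_mem].
- apply: Or32; exists K; split=> //; first by right.
  move=> y /Ksat[c [Qc sc]]; exists (a * c); split; first exact: primeM.
  by rewrite -mulrA; exact: iprod_mem.
- apply: Or33; apply: subset_trans sQQ.
  by apply: iprod_subr; exact: prodI_ideal.
Qed.

(** [Q] is the complement of a maximal multiplicative set containing [T0] and missing [I]. By
    maximality, enlarging that set by any [u] of [Q] must hit [I]; the last clause records this and
    says that, locally at [Q], [Q] is the radical of [I]. *)
Lemma exists_minimal_prime (T0 I : set T) : is_ideal I -> T0 1 ->
  (forall x y, T0 x -> T0 y -> T0 (x * y)) -> (forall x, T0 x -> ~ I x) ->
  exists Q, [/\ is_prime_ideal Q, I `<=` Q, forall x, T0 x -> ~ Q x &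
    forall u, Q u -> exists s n, ~ Q s /\ I (s * u ^+ n)].
Proof.
move=> iI T01 T0M T0I; have [I0 ID IM] := iI.
(* [T0] is added from outside because the empty chain has empty union, which must also satisfy the
   predicate. *)
pose mult A := (forall x y, (A `|` T0) x -> (A `|` T0) y -> (A `|` T0) (x * y)) /\
  forall x, A x -> ~ I x.
have [F FP totF|A [[AM AI] Amax]] := @Zorn_bigcup T mult.
  split; last by move=> x [A FA Ax]; exact: (FP _ FA).2.
  have sub A x : F A -> (A `|` T0) x -> (\bigcup_(X in F) X `|` T0) x.
    by move=> FA [Ax|]; [left; exists A|right].
  move=> x y [[A FA Ax]|T0x] [[B FB By]|T0y].
  - have [AB|BA] := totF _ _ FA FB.
      by apply: (sub B) => //; apply: (FP _ FB).1; left => //; exact: AB.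
    by apply: (sub A) => //; apply: (FP _ FA).1; left => //; exact: BA.
  - by apply: (sub A) => //; apply: (FP _ FA).1; [left|right].
  - by apply: (sub B) => //; apply: (FP _ FB).1; [right|left].
  - by right; exact: T0M.
pose S := A `|` T0.
have SI x : S x -> ~ I x by case=> [/AI|/T0I].
have S1 : S 1 by right.
have key u : ~ S u -> exists s n, S s /\ I (s * u ^+ n).
  move=> Su; apply: contrapT => nk.
  pose B := [set w | exists s n, S s /\ w = s * u ^+ n].
  have SB : S `<=` B by move=> s Ss; exists s, 0%N; rewrite expr0 mulr1.
  have T0B : B `|` T0 = B.
    by apply/seteqP; split=> [x [//|Tx]|x]; [apply: SB; right|left].
  apply: (Amax B).
    split; last first.
      move=> /(_ u) BA; apply: Su; left; apply: BA; exists 1, 1%N.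
      by rewrite mul1r.
    by move=> x Ax; apply: SB; left.
  rewrite /mult T0B; split.
    move=> _ _ [s [n [Ss ->]]] [t [m [St ->]]]; exists (s * t), (n + m)%N.
    by rewrite mulrACA -exprD; split=> //; exact: AM.
  by move=> _ [s [n [Ss ->]]] Isn; apply: nk; exists s, n.
exists (~` S); have iQ : is_ideal (~` S).
  have crit u s n : S s -> I (s * u ^+ n) -> (~` S) u.
    move=> Ss Isu Su; apply: (SI _ _ Isu); apply: (AM) => //.
    by elim: n {Isu} => [|n IH]; rewrite ?expr0 // exprS; exact: AM.
  split; first by move=> /SI.
  - move=> x y /key[s [n [Ss Isx]]] /key[t [m [St Ity]]].
    apply: (crit _ (s * t) (n + m)%N); first exact: AM.
    rewrite exprDn mulr_sumr; apply: (big_ind (fun x => I x)) => // i _.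
    rewrite -mulr_natl; move: ('C(_, _)%:R) => k; have [im|mi] := leqP i m.
      have -> : (n + m - i = n + (m - i))%N by rewrite addnBA.
      rewrite exprD; have -> : s * t * (k * (x ^+ n * x ^+ (m - i) * y ^+ i)) =
        (t * (k * (x ^+ (m - i) * y ^+ i))) * (s * x ^+ n) by ring.
      exact: IM.
    rewrite -[in y ^+ i](subnKC (ltnW mi)) exprD.
    have -> : s * t * (k * (x ^+ (n + m - i) * (y ^+ m * y ^+ (i - m)))) =
      (s * (k * (x ^+ (n + m - i) * y ^+ (i - m)))) * (t * y ^+ m) by ring.
    exact: IM.
  - move=> r x /key[s [n [Ss Isx]]]; apply: (crit _ s n) => //.
    by rewrite exprMn mulrCA; exact: IM.
split.
- split=> // a b Sab; apply: contrapT => /not_orP[/contrapT Sa /contrapT Sb].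
  by apply: Sab; exact: AM.
- by move=> x Ix Sx; exact: SI Ix.
- by move=> x T0x; apply; right.
- by move=> u /key[s [n [Ss Isu]]]; exists s, n; split=> // /(_ Ss).
Qed.

Lemma exists_maximal_ideal I : is_ideal I -> ~ I 1 ->
  exists M, is_maximal_ideal M /\ I `<=` M.
Proof.
move=> iI I1.
pose prop A := A = set0 \/ [/\ is_ideal A, I `<=` A & ~ A 1].
have [F FP totF|M [PM Mmax]] := @Zorn_bigcup T prop.
  have [[A [FA [x Ax]]]|F0] := pselect (exists A, F A /\ A !=set0); last first.
    left; apply/seteqP; split=> // x [A FA Ax]; apply: F0.
    by exists A; split=> //; exists x.
  have FI B y : F B -> B y -> [/\ is_ideal B, I `<=` B & ~ B 1].
    by move=> FB By; have [B0|//] := FP _ FB; move: By; rewrite B0.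
  have [[A0 _ _] IA _] := FI _ _ FA Ax.
  right; split; last by move=> [B FB B1]; have [_ _] := FI _ _ FB B1; exact.
    split; first by exists A.
    - move=> u w [B FB Bu] [C FC Cw].
      have [[_ BD _] _ _] := FI _ _ FB Bu; have [[_ CD _] _ _] := FI _ _ FC Cw.
      have [BC|CB] := totF _ _ FB FC.
        by exists C => //; apply: CD => //; exact: BC.
      by exists B => //; apply: BD => //; exact: CB.
    - move=> r u [B FB Bu]; have [[_ _ BM] _ _] := FI _ _ FB Bu.
      by exists B => //; exact: BM.
  by move=> y Iy; exists A => //; exact: IA.
case: PM => [M0|[iM IM M1]].
  exfalso; apply: (Mmax I); last by right; split.
  rewrite M0; split=> // sI0; have [I0 _ _] := iI; exact: sI0 I0.
exists M; split=> //; split=> // J iJ MJ.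
have [J1|J1] := pselect (J 1); first by right; exact: ideal_setT.
left; apply: contrapT => JM; apply: (Mmax J).
  by split=> // sJM; apply: JM; apply/seteqP; split.
by right; split=> //; exact: subset_trans MJ.
Qed.

Lemma maximal_comax M a : is_maximal_ideal M -> ~ M a ->
  exists r, M (1 - r * a).
Proof.
move=> [iM M1 Mmax] Ma; have [M0 _ _] := iM.
have iJ := isum_ideal iM (pideal_ideal a).
have [|JM|JT] := Mmax _ iJ.
- by apply: isuml; case: (pideal_ideal a).
- case: Ma; rewrite -JM; apply: isumr => //; exact: pidealx.
- have : isum M (pideal a) 1 by rewrite JT.
  by move=> [m [_ [Mm [r ->] e]]]; exists r; rewrite e addrK.
Qed.

Lemma maximal_prime M : is_maximal_ideal M -> is_prime_ideal M.
Proof.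
move=> mM; have [iM M1 Mmax] := mM; split=> // a b Mab.
apply: contrapT => /not_orP[Ma Mb]; apply: Mb.
have [r Mr] := maximal_comax mM Ma; have [_ MD MM] := iM.
have -> : b = b * (1 - r * a) + r * (a * b) by ring.
by apply: MD; apply: MM.
Qed.

End IdealProducts.

(** * Localizations of SP-domains are discrete valuation rings *)

Section UniformizersInSPDomains.
Variable R : idomainType.
Hypothesis hSP : SP_domain R.
Implicit Types (I J M P Q : set R) (x y z a b c u w : R).

Lemma SP_factor I : is_ideal I -> ~ I 1 -> exists s,
  [/\ forall J, List.In J s -> is_ideal J, forall J, List.In J s -> is_radical J &
      prodI s = I].
Proof.
move=> iI I1; have [|s [sP sI]] := hSP iI; first by move=> IT; apply: I1; rewrite IT.
by exists s; split=> // J /sP[].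
Qed.

(** [x] generates the maximal ideal of the localization at [Q]. *)
Definition uniformizer Q x := Q x /\ Q `<=` sat Q (pideal x).

(* Factor [(x, z^2)]: exactly one radical factor lies in [Q], and it contains [z],
   so [c z] is in [(x, z^2)] for some [c] outside [Q]. *)
Lemma uniformizer_notin_square Q x : is_prime_ideal Q -> Q x ->
  ~ iprod Q Q x -> uniformizer Q x.
Proof.
move=> pQ Qx Q2x; split=> // z Qz; have [iQ Q1 _] := pQ; have [Q0 QD QM] := iQ.
pose I := isum (pideal x) (pideal (z ^+ 2)).
have iI : is_ideal I by apply: isum_ideal; exact: pideal_ideal.
have Ix : I x by apply: isuml (pidealx x); case: (pideal_ideal (z ^+ 2)).
have Iz : I (z ^+ 2) by apply: isumr (pidealx _); case: (pideal_ideal x).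
have IQ : I `<=` Q.
  by move=> _ [_ [_ [[r ->] [t ->] ->]]]; rewrite expr2 mulrA; apply: QD; exact: QM.
have [|s [sI sR sE]] := SP_factor iI; first by move=> /IQ.
have [[c [Qc]]|[J [Js JQ]]|sQQ] := prodI_trichotomy pQ sI.
- by rewrite sE => /IQ.
- have Jz : J z by apply: (sR _ Js z 1%N); apply: (prodI_sub sI Js); rewrite sE.
  move=> /(_ _ Jz)[c [Qc]]; rewrite sE => -[_ [_ [[r ->] [t ->] e]]].
  exists (c - t * z); split; last by exists r; rewrite mulrBl e; ring.
  by move=> Qctz; apply: Qc; rewrite -(subrK (t * z) c); apply: QD => //; exact: QM.
- by case: Q2x; apply: sQQ; rewrite sE.
Qed.

(** Each radical factor of [I] contains [I], hence locally contains [Q], because [Q] is locally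
    nilpotent modulo [I]. So [I] locally contains a power of [Q], which is [Q] again by
    idempotence. *)
Lemma idempotent_prime_sat Q I : is_prime_ideal Q -> is_ideal I -> I `<=` Q ->
  (forall u, Q u -> exists s n, ~ Q s /\ I (s * u ^+ n)) ->
  Q `<=` sat Q (iprod Q Q) -> Q `<=` sat Q I.
Proof.
move=> pQ iI IQ Qrad Qidem; have [iQ Q1 _] := pQ.
have [|s [sI sR sE]] := SP_factor iI; first by move=> /IQ.
have Is J : List.In J s -> I `<=` J by rewrite -sE; exact: prodI_sub.
rewrite -sE; elim: s {sE} sI sR Is => [|J s IH] sI sR Is.
  by move=> u Qu; exists 1.
have {}IH : Q `<=` sat Q (prodI s).
  by apply: IH => K Ks; [apply: sI|apply: sR|apply: Is]; right.
have JM : is_ideal (iprod J (prodI s)) by apply: iprod_ideal; apply: sI; left.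
have QJ : Q `<=` sat Q J.
  move=> u Qu; have [c [n [Qc Icu]]] := Qrad _ Qu; exists c; split=> //.
  have iJ : is_ideal J by apply: sI; left.
  apply: (sR J (or_introl erefl) _ n); have [_ _ JM'] := iJ.
  have -> : (c * u) ^+ n.+1 = c ^+ n * u * (c * u ^+ n) by rewrite exprMn !exprS; ring.
  by apply: JM'; apply: (Is J) => //; left.
move=> u /Qidem; case=> c [Qc QQc]; apply: satK => //; exists c; split=> //.
have [s0 sD _] := sat_ideal pQ JM.
move: (c * u) QQc; apply: iprod_sub => // a b /QJ[d [Qd Jd]] /IH[e [Qe pe]].
exists (d * e); split; first exact: primeM.
by rewrite mulrACA; exact: iprod_mem.
Qed.

(* Otherwise [Q] is idempotent and equals [P + zR] and [P + z^2R] up to elements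
   outside [Q], which forces [z] into [P]. *)
Lemma minimal_prime_uniformizer P Q z : is_prime_ideal P -> is_prime_ideal Q ->
  P `<=` Q -> Q z -> ~ P z ->
  (forall u, Q u -> exists s n, ~ Q s /\ isum P (pideal z) (s * u ^+ n)) ->
  exists x, uniformizer Q x.
Proof.
move=> pP pQ PQ Qz Pz Qrad; have [iP P1 _] := pP; have [iQ Q1 _] := pQ.
have [Q0 QD QM] := iQ.
have [Qidem|/nonsubset[x [Qx Q2x]]] := pselect (Q `<=` sat Q (iprod Q Q)); last first.
  exists x; apply: uniformizer_notin_square => // Q2x'; apply: Q2x.
  exact: sat_sub.
pose I := isum P (pideal (z ^+ 2)).
have iI : is_ideal I by apply: isum_ideal => //; exact: pideal_ideal.
have /(_ _ Qz) [] : Q `<=` sat Q I.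
  apply: idempotent_prime_sat => //.
    by move=> _ [p [_ [/PQ Qp [r ->] ->]]]; apply: QD => //; rewrite expr2 mulrA; exact: QM.
  move=> u /Qrad[s [n [Qs [p [_ [Pp [r ->] e]]]]]].
  exists (s ^+ 2), (n * 2)%N; split; first exact: primeX.
  rewrite exprM -exprMn e; exists ((p + r * z *+ 2) * p), (r ^+ 2 * z ^+ 2).
  by split; [case: iP => _ _; exact|exists (r ^+ 2)|ring].
move=> c [Qc [p [_ [Pp [r ->] e]]]]; exfalso.
have : P ((c - r * z) * z).
  have -> : (c - r * z) * z = p by rewrite mulrBl e; ring.
  by [].
case: pP => _ _ PP /PP[/PQ Qcr|//]; apply: Qc.
by rewrite -(subrK (r * z) c); apply: QD => //; exact: QM.
Qed.

(** * Orders with respect to a uniformizer *)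

Section Uniformizer.
Variables (Q : set R) (x : R).
Hypotheses (pQ : is_prime_ideal Q) (ux : uniformizer Q x) (x0 : x != 0).

(** In the localization at [Q], [a] is a unit times [x ^+ n]. *)
Definition has_order a n := exists s u, [/\ ~ Q s, ~ Q u & s * a = u * x ^+ n].

Lemma uniformizer_exp_notin_lt s w u n k : ~ Q s -> ~ Q u -> (k < n)%N ->
  s * u * x ^+ k <> w * x ^+ n.
Proof.
move=> Qs Qu kn e; apply: (primeM pQ Qs Qu).
have -> : s * u = w * x ^+ (n - k.+1) * x.
  apply: (mulIf (expf_neq0 k x0)); rewrite e -mulrA -exprS -mulrA -exprD.
  by congr (_ * _ ^+ _); lia.
by have [[_ _ QM] _ _] := pQ; apply: QM; exact: ux.1.
Qed.

Lemma has_order_ge s a w n k : ~ Q s -> s * a = w * x ^+ n -> has_order a k ->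
  (n <= k)%N.
Proof.
move=> Qs e [t [u [Qt Qu e']]]; rewrite leqNgt; apply/negP => kn.
apply: (uniformizer_exp_notin_lt (w := t * w) Qs Qu kn).
by rewrite -[s * u * _]mulrA -e' mulrCA e mulrA.
Qed.

Lemma has_order_uniq a n m : has_order a n -> has_order a m -> n = m.
Proof.
move=> on om; apply/eqP; rewrite eqn_leq; apply/andP; split.
  by have [s [u [Qs _ e]]] := on; exact: has_order_ge e om.
by have [s [u [Qs _ e]]] := om; exact: has_order_ge e on.
Qed.

Lemma has_orderM a b n m : has_order a n -> has_order b m -> has_order (a * b) (n + m).
Proof.
move=> [s [u [Qs Qu e]]] [t [w [Qt Qw e']]]; exists (s * t), (u * w).
by rewrite mulrACA e e' mulrACA -exprD; split=> //; exact: primeM.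
Qed.

Lemma has_order0P a : has_order a 0 <-> ~ Q a.
Proof.
have [[_ _ QM] Q1 QP] := pQ; split=> [[s [u [Qs Qu]]]|Qa].
  by move=> e Qa; apply: Qu; rewrite -[u]mulr1 -(expr0 x) -e; exact: QM.
by exists 1, a; rewrite expr0 mul1r mulr1.
Qed.

Lemma has_order_or_infty a : (exists n, has_order a n) \/
  forall n, sat Q (pideal (x ^+ n)) a.
Proof.
have [|/existsNP[n Sn]] := pselect (forall n, sat Q (pideal (x ^+ n)) a); first by right.
left; elim: n Sn => [|n IH] Sn.
  by case: Sn; exists 1; rewrite expr0; split; [case: pQ|exists (1 * a); rewrite mulr1].
have [[s [Qs [w e]]]|/IH//] := pselect (sat Q (pideal (x ^+ n)) a).
exists n, s, w; split=> // /ux.2[t [Qt [r e']]]; apply: Sn; exists (t * s).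
by split; [exact: primeM|exists r; rewrite -mulrA e mulrA e' exprS mulrA].
Qed.

(** Finite orders add, so a product of two elements of finite order has finite order. This is the
    prime in which a nonzero element without order would have to lie. *)
Lemma infty_prime : is_prime_ideal [set a | forall n, sat Q (pideal (x ^+ n)) a].
Proof.
have iS n : is_ideal (sat Q (pideal (x ^+ n))) by apply: sat_ideal => //; exact: pideal_ideal.
have inftyN a n : has_order a n -> ~ sat Q (pideal (x ^+ n.+1)) a.
  by move=> oa [s [Qs [w e]]]; have := has_order_ge Qs e oa; rewrite ltnn.
split; first split.
- by move=> n; case: (iS n).
- by move=> a b Sa Sb n; have [_ SD _] := iS n; exact: SD.
- by move=> r a Sa n; have [_ _ SM] := iS n; exact: SM.
- by move=> /(_ 1%N); apply: (inftyN _ 0%N); apply/has_order0P; case: pQ.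
- move=> a b Sab; have [[n oa]|] := has_order_or_infty a; last by left.
  have [[m ob]|] := has_order_or_infty b; last by right.
  by have := inftyN _ _ (has_orderM oa ob) (Sab _).
Qed.

(* A radical factor [J] of [aR] is invertible, hence generated by some [q] up to
   elements outside [Q]; if [q] were infinitely divisible by [x], then [q / x]
   would lie in [J], as its square does. *)
Lemma has_order_exists a : a != 0 -> exists n, has_order a n.
Proof.
move=> a0; have [//|Sa] := has_order_or_infty a; exfalso.
pose Qoo := [set a | forall n, sat Q (pideal (x ^+ n)) a].
have pQoo : is_prime_ideal Qoo := infty_prime.
have [iQoo Qoo1 _] := pQoo; have [iQ Q1 _] := pQ; have [Q0 QD QM] := iQ.
have aQ : pideal a `<=` Qoo by exact: pideal_sub.
have [|s [sI sR sE]] := SP_factor (pideal_ideal a); first by move=> /aQ.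
have [|J [Js JQ]] := prime_prodI pQoo sI; first by rewrite sE.
have [B JB] := prodI_factor sI Js; rewrite sE in JB.
have JBa j b : J j -> B b -> exists t, j * b = t * a.
  by move=> Jj Bb; have : iprod J B (j * b) by [exact: iprod_mem]; rewrite JB.
have [j [b [r [Jj Bb Qr e]]]] : exists j b r, [/\ J j, B b, ~ Q r & j * b = r * a].
  apply: contrapT => nex.
  suff : iprod J B `<=` [set w | exists r, Q r /\ w = r * a].
    rewrite JB => /(_ _ (pidealx a))[r [Qr]].
    by rewrite -[LHS]mul1r => /(mulIf a0) e; rewrite -e in Qr.
  apply: iprod_sub.
  - by exists 0; rewrite mul0r.
  - by move=> _ _ [r [Qr ->]] [t [Qt ->]]; exists (r + t); rewrite mulrDl; split=> //; exact: QD.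
  - move=> j b Jj Bb; have [r e] := JBa _ _ Jj Bb; exists r; split=> //.
    by apply: contrapT => Qr; apply: nex; exists j, b, r.
have gen i : J i -> exists t, r * i = t * j.
  move=> Ji; have [t e'] := JBa _ _ Ji Bb; exists t; apply: (mulIf a0).
  by rewrite mulrAC -e mulrAC [RHS]mulrAC -e' mulrC mulrCA; ring.
have j0 : j != 0.
  apply: contra_notN Qr => /eqP j0; move: e; rewrite j0 mul0r => /esym/eqP.
  by rewrite mulf_eq0 (negPf a0) orbF => /eqP ->.
have [c [Qc [w e2]]] := JQ _ Jj 2%N.
have Jxw : J (x * w).
  apply: (sR _ Js _ 1%N).
  have -> : (x * w) ^+ 2 = w * (w * x ^+ 2) by ring.
  by have [_ _ JM] := sI _ Js; rewrite -e2 mulrA; exact: JM.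
have [t e3] := gen _ Jxw; apply: (primeM pQ Qr Qc).
have -> : r * c = t * x.
  by apply: (mulIf j0); rewrite -mulrA e2 mulrAC -e3; ring.
by apply: QM; exact: ux.1.
Qed.

(** A nonzero element of [P] has an order, so [P] contains some [u * x ^+ n] with [u] outside [Q];
    hence it contains [x], and then all that [x] generates locally. *)
Lemma uniformizer_height1 P z : is_prime_ideal P -> P `<=` Q -> Q z -> P z \/
  forall a, P a -> a = 0.
Proof.
move=> pP PQ Qz; have [|Pz] := pselect (P z); first by left.
right=> p Pp; apply/eqP; apply: contrapT => /negP p0.
have [[_ _ PM] _ PP] := pP; have [n [s [u [Qs Qu e]]]] := has_order_exists p0.
have Px : P x.
  have : P (u * x ^+ n) by rewrite -e; exact: PM.
  move=> /PP[/PQ//|]; apply: contraPP => Px; exact: primeX.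
have [c [Qc [r e']]] := ux.2 _ Qz; have : P (c * z) by rewrite e'; exact: PM.
by move=> /PP[/PQ|].
Qed.

End Uniformizer.

(** * Nonzero primes carry uniformizers and are maximal *)

Lemma uniformizer_neq0 Q x a : is_prime_ideal Q -> uniformizer Q x -> Q a ->
  a != 0 -> x != 0.
Proof.
move=> pQ [_ ux] /ux[c [Qc [r e]]] a0; apply: contraPN a0 => /eqP x0.
move: e; rewrite x0 mulr0 => /eqP; rewrite mulf_eq0 => /orP[/eqP c0|]; last by move=> ->.
by case: Qc; rewrite c0; case: pQ => -[].
Qed.

Lemma exists_minimal_uniformizer P M z : is_prime_ideal P -> is_prime_ideal M ->
  P `<=` M -> M z -> ~ P z ->
  exists Q x, [/\ is_prime_ideal Q, P `<=` Q, Q `<=` M, Q z & uniformizer Q x].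
Proof.
move=> pP pM PM Mz Pz; have [iP P1 _] := pP; have [iM M1 _] := pM.
have iI := isum_ideal iP (pideal_ideal z).
have [_ MD MM] := iM; have [P0 _ _] := iP.
have [|||Q [pQ IQ QM Qrad]] := @exists_minimal_prime _ (~` M) _ iI => //.
- by move=> x y; exact: primeM.
- move=> w Mw [p [_ [/PM Mp [r ->] e]]]; apply: Mw.
  by rewrite e; apply: MD => //; exact: MM.
have PQ : P `<=` Q by apply: subset_trans IQ; apply: isuml; case: (pideal_ideal z).
have Qz : Q z by apply: IQ; apply: isumr (pidealx z).
have [x ux] := minimal_prime_uniformizer pP pQ PQ Qz Pz Qrad.
exists Q, x; split=> // w Qw; apply: contrapT => Mw; exact: QM Qw.
Qed.

Lemma zero_prime : is_prime_ideal [set 0 : R].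
Proof.
split; first split => //=.
- by move=> _ _ -> ->; rewrite addr0.
- by move=> r _ ->; rewrite mulr0.
- by move=> /eqP; rewrite (negPf (oner_neq0 _)).
- by move=> a b /= /eqP; rewrite mulf_eq0 => /orP[/eqP|/eqP]; [left|right].
Qed.

(** Let [Q] be minimal over [a] inside [M]. If [Q] were smaller than [M], a prime [Q'] minimal over
    [Q] and an element of [M] outside [Q] would have a uniformizer too, although it lies strictly
    above the nonzero prime [Q]: this contradicts [uniformizer_height1]. *)
Lemma prime_uniformizer M a : is_prime_ideal M -> M a -> a != 0 ->
  exists x, uniformizer M x /\ x != 0.
Proof.
move=> pM Ma a0; have [[M0 _ _] _ _] := pM.
have [||Q [x [pQ _ QM Qa ux]]] := exists_minimal_uniformizer zero_prime pM _ Ma.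
- by move=> _ ->.
- by move/eqP; rewrite (negPf a0).
have x0 := uniformizer_neq0 pQ ux Qa a0.
suff -> : M = Q by exists x.
apply/seteqP; split=> // z Mz; apply: contrapT => Qz.
have [Q' [x' [pQ' QQ' _ Q'z ux']]] := exists_minimal_uniformizer pQ pM QM Mz Qz.
have x'0 := uniformizer_neq0 pQ' ux' (QQ' _ Qa) a0.
have [//|Q0] := uniformizer_height1 pQ' ux' x'0 pQ QQ' Q'z.
by move: a0; rewrite (Q0 _ Qa) eqxx.
Qed.

Lemma nonzero_prime_maximal P a : is_prime_ideal P -> P a -> a != 0 ->
  is_maximal_ideal P.
Proof.
move=> pP Pa a0; have [iP P1 _] := pP.
have [M [mM PM]] := exists_maximal_ideal iP P1.
have pM := maximal_prime mM.
have [x [ux x0]] := prime_uniformizer pM (PM _ Pa) a0.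
suff -> : P = M by [].
apply/seteqP; split=> // z Mz.
have [//|P0] := uniformizer_height1 pM ux x0 pP PM Mz.
by move: a0; rewrite (P0 _ Pa) eqxx.
Qed.

End UniformizersInSPDomains.

(** * Valuations *)

Section Valuation.
Variable R : idomainType.
Hypotheses (hSP : SP_domain R) (hnf : not_field R).
Local Notation K := {fraction R}.
Implicit Types (M : set R) (a b c d s u : R) (k l : K).

Lemma fraction_repr k : exists a b : R, b != 0 /\ k = tofrac a / tofrac b.
Proof.
elim/quotW: k => r; exists (frac r).1, (frac r).2; split; first exact: denom_ratioP.
have d0 : tofrac (frac r).2 != 0 :> K by rewrite tofrac_eq0; exact: denom_ratioP.
apply: (mulIf d0); rewrite divfK //.
rewrite -[_ * _]/(FracField.mul _ _) !piE.
apply/eqmodP; rewrite /= FracField.equivfE /FracField.mulf.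
rewrite !numden_Ratio ?mulr1 ?oner_eq0 ?denom_ratioP //.
by rewrite mulrC.
Qed.

Lemma fraction_repr_neq0 k : k != 0 ->
  exists a b : R, [/\ a != 0, b != 0 & k = tofrac a / tofrac b].
Proof.
move=> k0; have [a [b [b0 e]]] := fraction_repr k; exists a, b; split=> //.
by apply: contraNneq k0 => a0; rewrite e a0 tofrac0 mul0r.
Qed.

Lemma maximal_nonzero M : is_maximal_ideal M -> exists a, M a /\ a != 0.
Proof.
move=> [[M0 _ _] M1 Mmax]; apply: contrapT => nex.
have [x [x0 /negP xU]] := hnf.
have Mz a : M a -> a = 0.
  by move=> Ma; apply/eqP/negPn/negP => a0; apply: nex; exists a.
have [|xM|xT] := Mmax _ (pideal_ideal x).
- by move=> _ /Mz ->; case: (pideal_ideal x).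
- by move/eqP: x0; apply; apply: Mz; rewrite -xM; exact: pidealx.
- apply: xU; have : pideal x 1 by rewrite xT.
  by move=> [r e]; apply/unitrPr; exists r; rewrite mulrC.
Qed.

Section Order.
Variables (M : set R) (x : R).
Hypotheses (pM : is_prime_ideal M) (ux : uniformizer M x) (x0 : x != 0).

Definition ord a : nat := xget 0%N [set n | has_order M x a n].

Lemma ordP a : a != 0 -> has_order M x a (ord a).
Proof. by move=> a0; apply: (xgetPex 0%N); exact: (has_order_exists hSP). Qed.

Lemma ordE a n : a != 0 -> has_order M x a n -> ord a = n.
Proof. by move=> a0 oa; apply: has_order_uniq oa => //; exact: ordP. Qed.

Lemma ordM a b : a != 0 -> b != 0 -> ord (a * b) = (ord a + ord b)%N.
Proof.
move=> a0 b0; apply: ordE; first exact: mulf_neq0.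
by apply: has_orderM; rewrite //; exact: ordP.
Qed.

Lemma ordD a b : a != 0 -> b != 0 -> a + b != 0 -> (ord a <= ord b)%N ->
  (ord a <= ord (a + b))%N.
Proof.
move=> a0 b0 ab0 ab; have [s [u [Ms Mu e]]] := ordP a0.
have [t [w [Mt Mw e']]] := ordP b0.
apply: (@has_order_ge _ _ _ pM ux x0 (s * t) (a + b) (t * u + s * w * x ^+ (ord b - ord a))).
- exact: primeM.
- have -> : s * t * (a + b) = t * (s * a) + s * (t * b) by ring.
  by rewrite e e' mulrDl -[in LHS](subnK ab) exprD !mulrA.
- exact: ordP.
Qed.

Definition frac_ord k : int :=
  let p := projT1 (cid (fraction_repr k)) in
  let q := projT1 (cid (projT2 (cid (fraction_repr k)))) in
  (ord p)%:Z - (ord q)%:Z.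

Lemma frac_ordE a b : a != 0 -> b != 0 ->
  frac_ord (tofrac a / tofrac b) = (ord a)%:Z - (ord b)%:Z.
Proof.
move=> a0 b0; rewrite /frac_ord; case: cid => /= c Hc; case: cid => /= d [d0].
have fb0 : tofrac b != 0 :> K by rewrite tofrac_eq0.
have fd0 : tofrac d != 0 :> K by rewrite tofrac_eq0.
move/eqP; rewrite eqr_div // -!tofracM tofrac_eq => /eqP e.
have c0 : c != 0.
  by apply: contraTneq (mulf_neq0 a0 d0) => c0; rewrite e c0 mul0r eqxx.
by have := ordM a0 d0; rewrite e ordM //; lia.
Qed.

Lemma frac_ord_valuation : is_valuation_of M frac_ord.
Proof.
have fr0 a : a != 0 -> tofrac a != 0 :> K by rewrite tofrac_eq0.
split.
- move=> k l /fraction_repr_neq0[a [b [a0 b0 ->]]] /fraction_repr_neq0[c [d [c0 d0 ->]]].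
  rewrite mulf_div -!tofracM !frac_ordE ?mulf_neq0 // !ordM //; lia.
- move=> k l /fraction_repr_neq0[a [b [a0 b0 ->]]] /fraction_repr_neq0[c [d [c0 d0 ->]]].
  rewrite addf_div ?fr0 // -!tofracM -tofracD => n0.
  have {}n0 : a * d + c * b != 0.
    by apply: contraNneq n0 => ->; rewrite tofrac0 mul0r.
  rewrite !frac_ordE ?mulf_neq0 // ordM //.
  have ad0 := mulf_neq0 a0 d0; have cb0 := mulf_neq0 c0 b0.
  have ead := ordM a0 d0; have ecb := ordM c0 b0.
  have [le|le] := leqP (ord (a * d)) (ord (c * b)).
    by left; have := ordD ad0 cb0 n0 le; lia.
  right; have n0' : c * b + a * d != 0 by rewrite addrC.
  have := ordD cb0 ad0 n0' (ltnW le); rewrite [c * b + _]addrC ecb.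
  by move: (ord (a * d + _)) => n; lia.
- exists (tofrac x); split; first exact: fr0.
  have -> : tofrac x = tofrac x / tofrac 1 :> K by rewrite tofrac1 divr1.
  have M1 : ~ M 1 by case: pM.
  rewrite frac_ordE ?oner_neq0 // (ordE (n := 1%N)) // ?(ordE (n := 0%N)) ?oner_neq0 //.
    exact/has_order0P.
  by exists 1, 1; split=> //; rewrite expr1.
- move=> k k0; split.
    move=> [a [s [Ms e]]]; rewrite e in k0 *.
    have a0 : a != 0 by apply: contraNneq k0 => ->; rewrite tofrac0 mul0r.
    have s0 : s != 0 by apply: contra_notN Ms => /eqP ->; case: pM => -[].
    rewrite frac_ordE // (ordE (n := 0%N) s0) //; exact/has_order0P.
  move/fraction_repr_neq0: k0 => [a [b [a0 b0 ->]]]; rewrite frac_ordE // => ge0.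
  have [s [u [Ms Mu e]]] := ordP a0; have [t [w [Mt Mw e']]] := ordP b0.
  (* Locally [a] is [(u / s) * x ^+ ord a] and [b] is [(w / t) * x ^+ ord b]; this is their quotient
     with denominators cleared. *)
  exists (u * t * x ^+ (ord a - ord b)), (s * w); split; first exact: primeM.
  have nz c : ~ M c -> c != 0.
    by move=> Mc; apply: contra_notN Mc => /eqP ->; case: pM => -[].
  have fsw : tofrac (s * w) != 0 :> K by apply: fr0; apply: mulf_neq0; exact: nz.
  have fb := fr0 _ b0; apply/eqP; rewrite eqr_div // -!tofracM tofrac_eq.
  apply/eqP; have -> : a * (s * w) = w * (s * a) by ring.
  have -> : u * t * x ^+ (ord a - ord b) * b = u * x ^+ (ord a - ord b) * (t * b) by ring.
  have {}e : s * a = u * (x ^+ (ord a - ord b) * x ^+ ord b).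
    by rewrite e -exprD subnK //; lia.
  by rewrite e e'; ring.
Qed.

End Order.

Lemma vMP M : is_maximal_ideal M -> is_valuation_of M (vM M).
Proof.
move=> mM; rewrite /vM; case: pselect => [h|nex]; first by case: cid.
have pM := maximal_prime mM; have [a [Ma a0]] := maximal_nonzero mM.
have [x [ux x0]] := prime_uniformizer hSP pM Ma a0.
by case: nex; exists (frac_ord M x); exact: frac_ord_valuation.
Qed.

End Valuation.

(** * Locally constant functions and compact sets *)

Section LocallyConstant.
Variable X : topologicalType.
Implicit Types (f g : X -> int) (A B C U W : set X) (x y : X).

Definition onear x A := exists U, [/\ open U, U x & U `<=` A].

Lemma onearS x A B : A `<=` B -> onear x A -> onear x B.
Proof. by move=> AB [U [oU Ux UA]]; exists U; split=> //; exact: subset_trans AB. Qed.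

Lemma onearS2 x A B C : (forall y, A y -> B y -> C y) -> onear x A -> onear x B ->
  onear x C.
Proof.
move=> ABC [U [oU Ux UA]] [W [oW Wx WB]]; exists (U `&` W); split=> //.
  exact: openI.
by move=> y [/UA Ay /WB]; exact: ABC.
Qed.

Lemma onearT x A : (forall y, A y) -> onear x A.
Proof. by move=> At; exists setT; split=> //; exact: openT. Qed.

Lemma open_onear x A : open A -> A x -> onear x A.
Proof. by move=> oA Ax; exists A; split. Qed.

Lemma open_local A : (forall x, A x -> onear x A) -> open A.
Proof.
move=> AP; rewrite openE => x /AP[B [oB Bx BA]].
by apply: (filterS BA); exact: open_nbhs_nbhs.
Qed.

Definition lcst f := forall x, onear x [set y | f y = f x].

Lemma lcstP f : lcst f <-> forall A : set int, open (f @^-1` A).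
Proof.
split=> [lf A|cf x]; last exact: (open_onear (cf [set f x])).
by apply: open_local => x Afx; apply: onearS (lf x) => y /= e; rewrite e.
Qed.

Lemma lcst_cst (c : int) : lcst (fun=> c).
Proof. by move=> x; exact: onearT. Qed.

Lemma lcst_op2 (op : int -> int -> int) f g : lcst f -> lcst g ->
  lcst (fun x => op (f x) (g x)).
Proof. by move=> lf lg x; apply: onearS2 (lf x) (lg x) => y /= -> ->. Qed.

(** If no finite subfamily covered [A], the traces on [A] of the complements of finite unions would
    generate a proper filter, and its cluster point would lie in no [F i]. *)
Lemma compact_list_cover A (I : Type) (F : I -> set X) : compact A ->
  (forall i, open (F i)) -> (forall x, A x -> exists i, F i x) ->
  exists s : seq I, forall x, A x -> exists i, List.In i s /\ F i x.
Proof.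
move=> cA oF FA; apply: contrapT => nex.
pose B (s : seq I) := A `&` [set x | forall i, List.In i s -> ~ F i x].
have FF : ProperFilter (filter_from [set: seq I] B).
  apply: filter_from_proper => [|s _]; last first.
    apply: contrapT => B0; apply: nex; exists s => x Ax; apply: contrapT => nx.
    by apply: B0; exists x; split=> // i si Fi; apply: nx; exists i.
  apply: filter_from_filter; first by exists [::].
  move=> s t _ _; exists (s ++ t) => // x [Ax xst]; split; split=> // i ii.
    by apply: xst; apply: List.in_or_app; left.
  by apply: xst; apply: List.in_or_app; right.
have [|x [Ax clx]] := cA _ FF; first by exists [::] => // x [].
have [i Fix] := FA _ Ax.
have [||y [[_ nF] Fiy]] := clx (B [:: i]) (F i).
- by exists [:: i].
- by apply: open_nbhs_nbhs; split.
- by apply: (nF i) => //; left.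
Qed.

Lemma compact_lcst_bounded A f : compact A -> lcst f ->
  exists m : nat, forall x, A x -> (`|f x| <= m)%N.
Proof.
move=> cA /lcstP lf.
have [|x Ax|s sP] := @compact_list_cover A nat (fun n => f @^-1` [set z | `|z| <= n]%N) cA.
- by move=> n; exact: lf.
- by exists `|f x|%N => /=.
exists (\sum_(n <- s) n)%N => x /sP[n [sn /= le]]; apply: (leq_trans le).
elim: s {sP} sn => //= k s IH [->|/IH{}le]; rewrite big_cons; first exact: leq_addr.
by apply: leq_trans le _; exact: leq_addl.
Qed.

Lemma CcP f : Cc f <-> lcst f /\ exists C, [/\ compact C, closed C &
  forall x, f x != 0 -> C x].
Proof.
split=> [[/lcstP lf cf]|[lf [C [cC clC fC]]]].
  split=> //; exists (closure [set x | f x != 0]); split=> //.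
    exact: closed_closure.
  by move=> x fx; exact: (@subset_closure _ [set y | f y != 0]).
split; first exact/lcstP.
apply: (subclosed_compact _ cC); first exact: closed_closure.
by rewrite [X in _ `<=` X]((closure_id C).1 clC); apply: closure_subset.
Qed.

Lemma Cc_bounded f : Cc f -> exists m : nat, forall x, (`|f x| <= m)%N.
Proof.
move=> /CcP[lf [C [cC _ fC]]]; have [m mP] := compact_lcst_bounded cC lf.
exists m => x; have [->|/fC/mP//] := eqVneq (f x) 0; by rewrite absz0.
Qed.

Lemma Cc_op2 (op : int -> int -> int) f g : op 0 0 = 0 -> Cc f -> Cc g ->
  Cc (fun x => op (f x) (g x)).
Proof.
move=> op0 /CcP[lf [C [cC clC fC]]] /CcP[lg [D [cD clD gD]]]; apply/CcP.
split; first exact: lcst_op2.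
exists (C `|` D); split; [exact: compactU|exact: closedU|move=> x].
have [->|/fC Cx _] := eqVneq (f x) 0; last by left.
by have [->|/gD Dx _] := eqVneq (g x) 0; [rewrite op0|right].
Qed.

Lemma Cc_op1 (op : int -> int) f : op 0 = 0 -> Cc f -> Cc (fun x => op (f x)).
Proof. by move=> op0 cf; exact: (Cc_op2 (op := fun a _ => op a) op0 cf cf). Qed.

End LocallyConstant.

Lemma lcst_comp (X Y : topologicalType) (j : Y -> X) (f : X -> int) : continuous j -> lcst f ->
  lcst (f \o j).
Proof.
move=> /continuousP cj lf y; have [U [oU Uy Uf]] := lf (j y).
by exists (j @^-1` U); split=> //; [exact: cj|move=> z /Uf].
Qed.

(** * The inverse topology on the maximal spectrum *)

Lemma list_choice (S I : Type) (P : I -> S -> Prop) (s : seq S) :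
  (forall p, List.In p s -> exists i, P i p) ->
  exists t : seq I, forall p, List.In p s -> exists i, List.In i t /\ P i p.
Proof.
elim: s => [|p s IH] sP; first by exists [::].
have [i ip] := sP p (or_introl erefl).
have [|t tP] := IH; first by move=> q qs; apply: sP; right.
exists (i :: t) => q /= [<-|/tP[k [kt kq]]]; first by exists i; split; [left|].
by exists k; split; [right|].
Qed.

Section MaximalSpectrum.
Variable R : idomainType.
Implicit Types (a b c : R) (M : MaxT R).

Definition V a : set (MaxT R) := [set M | sval M a].

Lemma MaxT_prime M : is_prime_ideal (sval M).
Proof. by apply: maximal_prime; exact: svalP M. Qed.

Lemma MaxT_ideal M : is_ideal (sval M).
Proof. by case: (MaxT_prime M). Qed.

(** If a power of [a] lies in the ideal generated by all [F i], the finitely many summands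
    expressing it select a finite subcover. Otherwise some prime contains that ideal and avoids [a],
    so it is not covered. *)
Lemma zD1_zcompact a : zcompact (zD [set a]).
Proof.
move=> I F cov; pose J := iprod setT [set x | exists i, F i x].
have iJ : is_ideal J by apply: iprod_ideal; exact: setT_ideal.
have [[n [s [sP e]]]|nex] := pselect (exists n, J (a ^+ n)).
  have [|t tP] := @list_choice _ _ (fun i (p : R * R) => F i p.2) s.
    by move=> p /sP[].
  exists t => P [pP aP]; have [[P0 PD PM] P1 _] := pP; apply: contrapT => nt.
  have : ~ P (a ^+ n) by apply: primeX => // Pa; apply: aP => _ ->.
  apply; rewrite e; have {}tP p : List.In p s -> P p.2.
    move=> /tP[i [it Fi]]; apply: contrapT => Pp; apply: nt; exists i; split=> //.
    by split=> // /(_ _ Fi).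
  elim: s tP {sP e} => [|p s IH] tP; first by rewrite big_nil.
  rewrite big_cons; apply: PD; first by apply: PM; apply: tP; left.
  by apply: IH => q qs; apply: tP; right.
have [|||Q [pQ JQ aQ _]] := @exists_minimal_prime _ [set x | exists n, x = a ^+ n] _ iJ.
- by exists 0%N; rewrite expr0.
- by move=> _ _ [n ->] [m ->]; exists (n + m)%N; rewrite exprD.
- by move=> _ [n ->] Jn; apply: nex; exists n.
have [|i [_ []]] := cov Q.
  by split=> // /(_ a erefl); apply: aQ; exists 1%N; rewrite expr1.
move=> x Fx; apply: JQ; rewrite -[x]mul1r; apply: iprod_mem => //.
by exists i.
Qed.

Lemma V_subbase a : inv_subbase (V a).
Proof.
exists (zD [set a]); split; [by exists [set a]|exact: zD1_zcompact|].
apply/seteqP; split=> M /= Ma; first by move=> [_]; apply=> _ ->.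
apply: contrapT => nMa; apply: Ma; split; first exact: MaxT_prime.
by move=> /(_ a erefl).
Qed.

Lemma open_V a : open (V a).
Proof.
exists [set V a]; last by rewrite bigcup_set1.
by move=> _ ->; exact: (finI_from1 id (V_subbase a)).
Qed.

Lemma MaxT_comax M a : ~ sval M a -> exists r, sval M (1 - r * a).
Proof. by apply: maximal_comax; exact: svalP M. Qed.

(** A maximal ideal avoids [a] exactly when it contains some [1 - r * a], so the complement of [V a]
    is a union of sets [V b]. Thus [V a] is clopen, which is special to the maximal spectrum. *)
Lemma open_notV a : open (~` V a).
Proof.
apply: open_local => M /= Ma; have [r Mr] := MaxT_comax Ma.
exists (V (1 - r * a)); split=> //; first exact: open_V.
move=> N Nr Na; have [[_ ND NM] N1 _] := MaxT_prime N; apply: N1.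
by rewrite -(subrK (r * a) 1); apply: ND => //; exact: NM.
Qed.

Lemma closed_V a : closed (V a).
Proof. by rewrite -[V a]setCK; apply: open_closedC; exact: open_notV. Qed.

Lemma MaxT_inj M N : sval M `<=` sval N -> M = N.
Proof.
move: M N => [M mM] [N mN] /= MN; apply: eq_exist.
have [_ _ Mmax] := mM; have [iN N1 _] := mN.
by have [//|NT] := Mmax _ iN MN; case: N1; rewrite NT.
Qed.

(** The product over a finite subcover works. The multiplicative set [S] is kept general because it
    is later either the nonzero elements or the complement of a maximal ideal. *)
Lemma compact_sub_V (S : set R) (C : set (MaxT R)) : compact C -> S 1 ->
  (forall a b, S a -> S b -> S (a * b)) ->
  (forall M, C M -> exists a, S a /\ sval M a) ->
  exists a, S a /\ C `<=` V a.
Proof.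
move=> cC S1 SM CS.
have [|M /CS[a [Sa Ma]]|s sP] := @compact_list_cover _ C {a : R | S a}
  (fun a : {a : R | S a} => V (sval a)) cC.
- by move=> i; exact: open_V.
- by exists (exist _ a Sa).
exists (\prod_(a <- s) sval a); split.
  by elim: s {sP} => [|[a Sa] s IH]; rewrite ?big_nil // big_cons; exact: SM.
move=> M /sP[a [sa Ma]]; have [_ _ MM] := MaxT_ideal M.
elim: s sa {sP} => //= b s IH [e|/IH{}IH]; rewrite /V /= big_cons.
  by rewrite e mulrC; exact: MM.
exact: MM.
Qed.

Hypotheses (hSP : SP_domain R) (hnf : not_field R).

(* The limit of an ultrafilter [F] containing [V a] is the prime of all [b] with
   [V b] in [F]; being nonzero, it is maximal. *)
Lemma compact_V a : a != 0 -> compact (V a).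
Proof.
move=> a0; rewrite compact_ultra => F UF FVa.
pose P := [set b | F (V b)].
have pP : is_prime_ideal P.
  split; first split.
  - apply: filterS filterT => M _; by case: (MaxT_ideal M).
  - move=> b c /= Fb Fc; apply: filterS2 Fb Fc => M /= Mb Mc.
    by case: (MaxT_ideal M) => _ MD _; exact: MD.
  - move=> r b /= Fb; apply: filterS Fb => M /= Mb.
    by case: (MaxT_ideal M) => _ _ MM; exact: MM.
  - move=> F1; apply: (@filter_not_empty _ F); apply: filterS F1 => M /=.
    by case: (MaxT_prime M).
  - move=> b c Fbc; have [Fb|Fb] := in_ultra_setVsetC (V b) UF; first by left.
    right; apply: filterS2 Fbc Fb => M /= Mbc Mb.
    by case: (MaxT_prime M) => _ _ /(_ _ _ Mbc)[].
have mP : is_maximal_ideal P by apply: nonzero_prime_maximal pP FVa a0.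
pose p : MaxT R := exist _ P mP.
have subF A : inv_subbase A -> A p -> F A.
  move=> [U [[S US] cU ->]] /= Up; rewrite {}US in cU Up *.
  have SP : S `<=` P by apply: contrapT => SP; apply: Up.
  (* Compactness replaces [S] by finitely many of its elements, so the basic neighbourhood of [p]
     contains a finite intersection of sets [V s] belonging to [F]. *)
  have [|t tP] := cU {s | S s} (fun s => [set sval s]).
    move=> Q [pQ /nonsubset[s [Ss Qs]]]; exists (exist _ s Ss); split=> //.
    by move=> /(_ s erefl).
  have : F [set M : MaxT R | forall i, List.In i t -> sval M (sval i)].
    elim: t {tP} => [|i t IH]; first by apply: filterS filterT => M _ i [].
    have Fi : F (V (sval i)) by apply: SP; exact: svalP i.
    by apply: filterS2 Fi IH => M Mi Mt k [<-|/Mt].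
  apply: filterS => M Mt /= /tP[i [it [_ ni]]]; apply: ni => _ ->; exact: Mt.
exists p; split=> //; move=> A; rewrite nbhsE => -[B [oB Bp] BA].
apply: (filterS BA); have [D' D'sub eB] := oB; rewrite -eB in Bp *.
have [C D'C Cp] := Bp; apply: (@filterS _ F _ C); first by move=> M CM; exists C.
have [E Esub eC] := D'sub _ D'C; rewrite -eC in Cp *.
apply: filter_bigI => i Ei; apply: subF; last exact: Cp.
by have := Esub _ Ei; rewrite inE.
Qed.

Lemma compact_sub_nonzero_V (C : set (MaxT R)) : compact C ->
  exists a, a != 0 /\ C `<=` V a.
Proof.
move=> cC; apply: (@compact_sub_V [set a | a != 0]) => //=.
- exact: oner_neq0.
- by move=> a b; exact: mulf_neq0.
- move=> M _; have [a [Ma a0]] := maximal_nonzero hnf (svalP M).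
  by exists a.
Qed.

Lemma compact_sub_avoiding_V (C : set (MaxT R)) M : compact C -> ~ C M ->
  exists a, ~ sval M a /\ C `<=` V a.
Proof.
move=> cC CM; apply: (@compact_sub_V (~` sval M)) => //=.
- by case: (MaxT_prime M).
- by move=> a b; apply: primeM; exact: MaxT_prime.
- move=> N CN; apply: contrapT => nex; apply: CM.
  rewrite -(@MaxT_inj N M) // => a Na; apply: contrapT => Ma.
  by apply: nex; exists a.
Qed.

End MaximalSpectrum.

(** * Fractional ideals and their valuation functions *)

Section MinimalValue.
Variables (T : idomainType) (w : T -> int).
Hypothesis wM : forall x y, x != 0 -> y != 0 -> w (x * y) = w x + w y.
Hypothesis wD : forall x y, x != 0 -> y != 0 -> x + y != 0 ->
  w x <= w (x + y) \/ w y <= w (x + y).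
Implicit Types (A B : set T) (n m : int).

(** Stated over an arbitrary domain, since it serves both fractional ideals with [v M] and ideals of
    [R] with [v M \o tofrac]. *)
Definition is_min A n := (exists i, [/\ A i, i != 0 & w i = n]) /\
  (forall i, A i -> i != 0 -> n <= w i).

Lemma is_min_uniq A n m : is_min A n -> is_min A m -> n = m.
Proof.
move=> [[i [Ai i0 <-]] minA] [[k [Ak k0 <-]] minA'].
by apply/eqP; rewrite eq_le minA // minA'.
Qed.

Definition vge n x := x != 0 -> n <= w x.

Lemma vgeD n x y : vge n x -> vge n y -> vge n (x + y).
Proof.
move=> nx ny; have [->|x0] := eqVneq x 0; first by rewrite add0r.
have [->|y0] := eqVneq y 0; first by rewrite addr0.
by move=> xy0; have [|] := wD x0 y0 xy0; apply: le_trans; [exact: nx|exact: ny].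
Qed.

Lemma vgeM n m x y : vge n x -> vge m y -> vge (n + m) (x * y).
Proof.
move=> nx my; rewrite /vge mulf_eq0 negb_or => /andP[x0 y0].
by rewrite wM // lerD // ?nx ?my.
Qed.

Lemma is_min_iprod A B n m : is_min A n -> is_min B m -> is_min (iprod A B) (n + m).
Proof.
move=> [[a [Aa a0 <-]] minA] [[b [Bb b0 <-]] minB]; split.
  exists (a * b); rewrite wM // mulf_neq0 //; split=> //; exact: iprod_mem.
apply: (@iprod_sub _ _ _ (vge (w a + w b))) => [|x y|x y Ax By].
- by rewrite /vge eqxx.
- exact: vgeD.
- by apply: vgeM; [exact: minA|exact: minB].
Qed.

Lemma is_min_exists A n : (exists i, A i /\ i != 0) ->
  (forall i, A i -> i != 0 -> n <= w i) -> exists m, is_min A m.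
Proof.
move=> [i [Ai i0]] An.
have ex : exists k : nat, `[< exists i, [/\ A i, i != 0 & w i = n + k%:Z] >].
  by exists `|w i - n|%N; apply/asboolP; exists i; split=> //; have := An _ Ai i0; lia.
case: (ex_minnP ex) => k /asboolP[l [Al l0 lk]] kmin; exists (n + k%:Z); split.
  by exists l.
move=> l' Al' l'0; have := An _ Al' l'0 => le.
have := kmin `|w l' - n|%N.
have -> : `[< exists i, [/\ A i, i != 0 & w i = n + `|w l' - n|%N%:Z] >].
  by apply/asboolP; exists l'; split=> //; lia.
by move=> /(_ isT); lia.
Qed.

End MinimalValue.

Section FractionalIdeals.
Variable R : idomainType.
Hypotheses (hSP : SP_domain R) (hnf : not_field R).
Local Notation K := {fraction R}.
Local Notation v M := (vM (sval M)).
Implicit Types (M N : MaxT R) (a b c d : R) (x y z : K) (I J : set K).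

Lemma vP M : is_valuation_of (sval M) (v M).
Proof. by apply: vMP => //; exact: svalP M. Qed.

Lemma v_mul M x y : x != 0 -> y != 0 -> v M (x * y) = v M x + v M y.
Proof. by case: (vP M) => vmul _ _ _; exact: vmul. Qed.

Lemma v_add M x y : x != 0 -> y != 0 -> x + y != 0 ->
  v M x <= v M (x + y) \/ v M y <= v M (x + y).
Proof. by case: (vP M) => _ vadd _ _; exact: vadd. Qed.

Lemma v_loc M x : x != 0 -> (loc (sval M) x <-> 0 <= v M x).
Proof. by case: (vP M) => _ _ _ vloc; exact: vloc. Qed.

Lemma v1 M : v M 1 = 0.
Proof.
have e := v_mul M (oner_neq0 K) (oner_neq0 K); rewrite mulr1 in e.
by apply: (addrI (v M 1)); rewrite addr0 -e.
Qed.

Lemma vV M x : x != 0 -> v M x^-1 = - v M x.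
Proof.
move=> x0; have := v_mul M x0 (_ : x^-1 != 0); rewrite invr_eq0 => /(_ x0).
by rewrite divff // v1; lia.
Qed.

Lemma vX M x n : x != 0 -> v M (x ^+ n) = v M x *+ n.
Proof.
move=> x0; elim: n => [|n IH]; first by rewrite expr0 v1.
by rewrite exprS v_mul ?expf_neq0 // IH mulrS.
Qed.

Lemma tofrac_neq0 a : a != 0 -> tofrac a != 0 :> K.
Proof. by rewrite tofrac_eq0. Qed.

Lemma loc_tofrac M a : loc (sval M) (tofrac a).
Proof.
exists a, 1; rewrite tofrac1 divr1; split=> //.
by case: (MaxT_prime M).
Qed.

Lemma v_ge0 M a : a != 0 -> 0 <= v M (tofrac a).
Proof. by move=> /tofrac_neq0 a0; apply/v_loc => //; exact: loc_tofrac. Qed.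

Lemma notin_neq0 M a : ~ sval M a -> a != 0.
Proof. by move=> Ma; apply: contra_notN Ma => /eqP ->; case: (MaxT_ideal M). Qed.

Lemma v_eq0 M a : ~ sval M a -> v M (tofrac a) = 0.
Proof.
move=> Ma; have a0 := notin_neq0 Ma; have fa0 := tofrac_neq0 a0.
have : 0 <= v M (tofrac a)^-1.
  by apply/v_loc; rewrite ?invr_eq0 //; exists 1, a; rewrite tofrac1 mul1r.
by rewrite vV //; have := v_ge0 M a0; lia.
Qed.

Lemma v_gt0 M a : a != 0 -> sval M a -> 0 < v M (tofrac a).
Proof.
move=> a0 Ma; rewrite ltNge; apply/negP => le0; have fa0 := tofrac_neq0 a0.
have : loc (sval M) (tofrac a)^-1 by apply/v_loc; rewrite ?invr_eq0 // vV //; lia.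
move=> [b [s [Ms e]]]; apply: (Ms); have fs0 := tofrac_neq0 (notin_neq0 Ms).
have -> : s = a * b.
  apply/eqP; rewrite -tofrac_eq tofracM; apply/eqP; apply: (mulfI (invr_neq0 fa0)).
  by rewrite mulKf // e divfK.
by have [_ _ MM] := MaxT_ideal M; rewrite mulrC; exact: MM.
Qed.

Lemma v_uniformizer M : exists a, [/\ a != 0, sval M a & v M (tofrac a) = 1].
Proof.
case: (vP M) => _ _ [t [t0 vt]] _.
have : loc (sval M) t by apply/v_loc; rewrite // vt.
move=> [a [s [Ms e]]]; exists a; have fs0 := tofrac_neq0 (notin_neq0 Ms).
have a0 : a != 0 by apply: contraNneq t0 => a0; rewrite e a0 tofrac0 mul0r.
have va : v M (tofrac a) = 1.
  rewrite -(divfK fs0 (tofrac a)) v_mul ?v_eq0 // ?addr0 -?e //.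
by split=> //; apply: contrapT => /v_eq0; rewrite va.
Qed.

Lemma v_surj M (n : int) : exists x, x != 0 /\ v M x = n.
Proof.
have [a [a0 _ va]] := v_uniformizer M; have fa0 := tofrac_neq0 a0.
have pos k : v M (tofrac a ^+ k) = k%:Z by rewrite vX // va; lia.
case: n => k; first by exists (tofrac a ^+ k); rewrite expf_neq0.
exists (tofrac a ^+ k.+1)^-1; rewrite invr_eq0 expf_neq0 // vV ?expf_neq0 // pos.
by split=> //; lia.
Qed.

(** If the ideal of all [r] with [r * x] in [N] were proper, it would lie in some maximal [M]; but
    [x / i] lies in the local ring at [M], and its denominator belongs to that ideal without
    belonging to [M]. *)
Lemma local_global (N : set K) x : (forall x y, N x -> N y -> N (x + y)) ->
  (forall r x, N x -> N (tofrac r * x)) -> N 0 -> x != 0 ->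
  (forall M, exists i, [/\ N i, i != 0 & v M i <= v M x]) -> N x.
Proof.
move=> ND NM N0 x0 loc; pose J := [set r | N (tofrac r * x)].
have iJ : is_ideal J.
  split; rewrite /J /=; first by rewrite tofrac0 mul0r.
  - by move=> r s Jr Js; rewrite tofracD mulrDl; exact: ND.
  - by move=> r s Js; rewrite tofracM -mulrA; exact: NM.
have [|J1] := pselect (J 1); first by rewrite /J /= tofrac1 mul1r.
have [M0 [mM JM]] := exists_maximal_ideal iJ J1.
pose M : MaxT R := exist _ M0 mM; have [i [Ni i0 le]] := loc M.
have : Defs.loc M0 (x / i).
  apply/(v_loc M); first by rewrite mulf_neq0 // invr_eq0.
  by rewrite v_mul ?invr_eq0 // vV // subr_ge0.
move=> [a [s [Ms e]]]; have fs0 := tofrac_neq0 (@notin_neq0 M s Ms).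
case: Ms; apply: JM; rewrite /J /=.
have -> : tofrac s * x = tofrac a * i by apply/eqP; rewrite mulrC -eqr_div // -e.
exact: NM.
Qed.

Lemma frac_ideal_bounded I : is_frac_ideal I -> exists d, d != 0 /\
  forall M i, I i -> i != 0 -> - v M (tofrac d) <= v M i.
Proof.
move=> [_ _ _ [d [d0 dI]] _]; exists d; split=> // M i Ii i0.
have [a e] := dI _ Ii; have fd0 := tofrac_neq0 d0.
have a0 : a != 0 by rewrite -tofrac_eq0 -e mulf_neq0.
have := v_ge0 M a0; rewrite -e v_mul //; lia.
Qed.

Lemma nuP I M : is_frac_ideal I -> is_min (v M) I (nu I (sval M)).
Proof.
move=> fI; have [d [_ dI]] := frac_ideal_bounded fI; have [_ _ _ _ ex] := fI.
have [m minm] := is_min_exists (w := v M) ex (dI M).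
exact: (xgetPex 0 (ex_intro _ m minm)).
Qed.

Lemma nu_le I M x : is_frac_ideal I -> I x -> x != 0 -> nuM I M <= v M x.
Proof. by move=> fI Ix x0; apply: (nuP M fI).2. Qed.

Lemma nu_attained I M : is_frac_ideal I -> exists x, [/\ I x, x != 0 & v M x = nuM I M].
Proof. by move=> fI; exact: (nuP M fI).1. Qed.

Lemma nuE I M n : is_frac_ideal I -> is_min (v M) I n -> nuM I M = n.
Proof. by move=> fI; apply: is_min_uniq; exact: nuP. Qed.

Lemma mem_nu I x : is_frac_ideal I -> x != 0 ->
  (forall M, nuM I M <= v M x) -> I x.
Proof.
move=> fI x0 le; have [I0 ID IM _ _] := fI; apply: local_global => // M.
by have [i [Ii i0 vi]] := nu_attained M fI; exists i; rewrite vi.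
Qed.

Lemma nu_inj I J : is_frac_ideal I -> is_frac_ideal J -> nuM I = nuM J -> I = J.
Proof.
move=> fI fJ e; apply/seteqP; split=> x Ix.
  have [->|x0] := eqVneq x 0; first by case: fJ.
  by apply: mem_nu => // M; rewrite -e; exact: nu_le.
have [->|x0] := eqVneq x 0; first by case: fI.
by apply: mem_nu => // M; rewrite e; exact: nu_le.
Qed.

(** * Products and inverses of fractional ideals *)

Lemma Rset_frac : is_frac_ideal (@Rset R).
Proof.
split.
- by exists 0; rewrite tofrac0.
- by move=> _ _ [a ->] [b ->]; exists (a + b); rewrite tofracD.
- by move=> r _ [a ->]; exists (r * a); rewrite tofracM.
- by exists 1; rewrite oner_neq0; split=> // x; rewrite tofrac1 mul1r.
- by exists 1; rewrite oner_neq0; split=> //; exists 1; rewrite tofrac1.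
Qed.

Lemma Rset1 : @Rset R 1.
Proof. by exists 1; rewrite tofrac1. Qed.

Lemma RsetM x y : @Rset R x -> @Rset R y -> @Rset R (x * y).
Proof. by move=> [a ->] [b ->]; exists (a * b); rewrite tofracM. Qed.

Lemma nu_Rset M : nuM (@Rset R) M = 0.
Proof.
apply: nuE; first exact: Rset_frac.
split; first by exists 1; rewrite oner_neq0 v1; split=> //; exact: Rset1.
by move=> _ [a ->]; rewrite tofrac_eq0; exact: v_ge0.
Qed.

Lemma RsetP x : x != 0 -> (forall M, 0 <= v M x) -> @Rset R x.
Proof.
by move=> x0 ge0; apply: mem_nu => // [|M]; [exact: Rset_frac|rewrite nu_Rset].
Qed.

Lemma iprod_frac I J : is_frac_ideal I -> is_frac_ideal J -> is_frac_ideal (iprod I J).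
Proof.
move=> [I0 ID IM [d [d0 dI]] [i [Ii i0]]] [J0 JD JM [e [e0 eJ]] [j [Jj j0]]]; split.
- exact: iprod0.
- exact: iprodD.
- move=> r x IJx; move: x IJx; apply: (@iprod_sub _ _ _ [set x | iprod I J (tofrac r * x)]) => /=.
  + by rewrite mulr0; exact: iprod0.
  + by move=> x y ? ?; rewrite mulrDr; exact: iprodD.
  + by move=> x y Ix Jy; rewrite mulrA; apply: iprod_mem => //; exact: IM.
- exists (d * e); split; first exact: mulf_neq0.
  have [R0 RD _ _ _] := Rset_frac.
  apply: (@iprod_sub _ _ _ [set x | Rset (tofrac (d * e) * x)]) => /=.
  + by rewrite mulr0.
  + by move=> x y ? ?; rewrite mulrDr; exact: RD.
  + by move=> x y Ix Jy; rewrite tofracM mulrACA; apply: RsetM; [exact: dI|exact: eJ].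
- by exists (i * j); split; [exact: iprod_mem|exact: mulf_neq0].
Qed.

Lemma nu_iprod I J : is_frac_ideal I -> is_frac_ideal J ->
  nuM (iprod I J) = (fun M => nuM I M + nuM J M).
Proof.
move=> fI fJ; apply/funext => M; apply: nuE; first exact: iprod_frac.
by apply: is_min_iprod; [exact: v_mul|exact: v_add|exact: nuP|exact: nuP].
Qed.

Lemma colon_frac I : is_frac_ideal I -> is_frac_ideal (colon (@Rset R) I).
Proof.
move=> [I0 ID IM [d [d0 dI]] [i [Ii i0]]]; have [R0 RD RM _ _] := Rset_frac.
split; rewrite /colon /=.
- by move=> b _; rewrite mul0r.
- by move=> x y Hx Hy b Ib; rewrite mulrDl; apply: RD; [exact: Hx|exact: Hy].
- by move=> r x Hx b Ib; rewrite -mulrA; apply: RM; exact: Hx.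
- have [a [b [a0 b0 e]]] := fraction_repr_neq0 i0; have fb0 := tofrac_neq0 b0.
  exists a; split=> // x /(_ _ Ii) [c]; rewrite e => ec; exists (b * c).
  by rewrite tofracM -ec mulrCA [tofrac a / _]mulrC mulVKf // mulrC.
- by exists (tofrac d); rewrite tofrac_eq0; split=> // b /dI.
Qed.

Lemma colonP I x : is_frac_ideal I -> x != 0 ->
  colon (@Rset R) I x <-> forall M, - nuM I M <= v M x.
Proof.
move=> fI x0; split=> [xI M|ge b Ib].
  have [i [Ii i0 <-]] := nu_attained M fI; have [a e] := xI _ Ii.
  have a0 : a != 0 by rewrite -tofrac_eq0 -e mulf_neq0.
  by have := v_ge0 M a0; rewrite -e v_mul //; lia.
have [->|b0] := eqVneq b 0; first by rewrite mulr0; case: Rset_frac.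
apply: RsetP => [|M]; first exact: mulf_neq0.
by rewrite v_mul //; have := ge M; have := nu_le M fI Ib b0; lia.
Qed.

(** For a uniformizer [t] at [M], a power of [t] is locally a multiple of [a], so some
    [s * t ^+ n.1] with [s] outside [M] and a large exponent lies in [J]. Radicality then puts
    [s * t] itself, of value 1, in [J]. *)
Lemma is_min_radical M (J : set R) (a : R) : is_ideal J -> is_radical J -> J a -> a != 0 ->
  is_min (v M \o @tofrac R) J (`[< J `<=` sval M >] : nat)%:Z.
Proof.
move=> iJ rJ Ja a0; have [J0 JD JM] := iJ; have pM := MaxT_prime M.
case: asboolP => [JsM|/nonsubset[j [Jj Mj]]]; last first.
  split; first by exists j; rewrite (notin_neq0 Mj) /= v_eq0.
  by move=> i Ji i0; exact: v_ge0.
split; last by move=> i Ji i0; have := v_gt0 i0 (JsM _ Ji); rewrite /=; lia.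
have [t [t0 Mt vt]] := v_uniformizer M.
have ft0 := tofrac_neq0 t0; have fa0 := tofrac_neq0 a0.
have := v_gt0 a0 (JsM _ Ja); case va : (v M (tofrac a)) => [[|n]|n] // _.
have : loc (sval M) (tofrac t ^+ n.+1 / tofrac a).
  apply/v_loc; first by rewrite mulf_neq0 ?expf_neq0 ?invr_eq0.
  by rewrite v_mul ?expf_neq0 ?invr_eq0 // vV // vX // va vt; lia.
move=> [c [s [Ms e]]]; have s0 := notin_neq0 Ms; have fs0 := tofrac_neq0 s0.
have e' : s * t ^+ n.+1 = c * a.
  apply/eqP; rewrite -tofrac_eq !tofracM tofracXn mulrC -eqr_div //.
  by rewrite e.
exists (s * t); rewrite mulf_neq0 //; split=> //; last first.
  by rewrite /= tofracM v_mul // v_eq0 // vt.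
apply: (rJ _ n); have -> : (s * t) ^+ n.+1 = s ^+ n * (s * t ^+ n.+1).
  by rewrite exprMn exprSr; ring.
by rewrite e'; do 2 apply: (JM).
Qed.

(* The radical factors of [aR] are invertible, hence finitely generated, so that
   containing one of them is an open and closed condition on [M]. *)
Lemma lcst_v_tofrac a : a != 0 -> lcst (fun M => v M (tofrac a)).
Proof.
move=> a0; have fa0 := tofrac_neq0 a0.
have [u1|a1] := pselect (pideal a 1).
  have -> : (fun M => v M (tofrac a)) = (fun=> 0); last exact: lcst_cst.
  apply/funext => M; apply: v_eq0 => Ma; have [iM M1 _] := MaxT_prime M.
  by apply: M1; apply: (pideal_sub iM Ma).
have [s [sI sR sE]] := SP_factor hSP (pideal_ideal a) a1.
have aJ (J : set R) : List.In J s -> J a.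
  by move=> Js; apply: (prodI_sub sI Js); rewrite sE; exact: pidealx.
(* The value of [a] at [M] counts the radical factors of [aR] contained in [M], with
   multiplicity. *)
have -> : (fun M => v M (tofrac a)) =
    fun M => foldr (fun (J : set R) n => (`[< J `<=` sval M >] : nat)%:Z + n) 0 s.
  apply/funext => M; have minP : is_min (v M \o @tofrac R) (prodI s)
      (foldr (fun (J : set R) n => (`[< J `<=` sval M >] : nat)%:Z + n) 0 s).
    elim: s sI sR aJ {sE} => [|J s IH] sI sR aJ /=.
      split; first by exists 1; rewrite oner_neq0 /= tofrac1 v1.
      by move=> i _; exact: v_ge0.
    apply: is_min_iprod.
    - by move=> x y x0 y0; rewrite /= tofracM v_mul ?tofrac_eq0.
    - by move=> x y x0 y0 xy0; rewrite /= tofracD; apply: v_add; rewrite -?tofracD tofrac_eq0.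
    - by apply: (is_min_radical M) a0; [apply: sI|apply: sR|apply: aJ]; left.
    - by apply: IH => K Ks; [apply: sI|apply: sR|apply: aJ]; right.
  rewrite sE in minP; apply: is_min_uniq minP; split.
    by exists a; split=> //; exact: pidealx.
  move=> _ [r ->]; rewrite mulf_eq0 negb_or => /andP[r0 _].
  by rewrite /= tofracM v_mul ?tofrac_eq0 // lerDr v_ge0.
have lcJ (J : set R) : List.In J s -> lcst (fun M => (`[< J `<=` sval M >] : nat)%:Z).
  move=> Js M; have [B JB] := prodI_factor sI Js; rewrite sE in JB.
  have [JM|JM] := pselect (J `<=` sval M); last first.
    have [j [Jj Mj]] := nonsubset JM.
    apply: onearS (open_onear (open_notV j) (Mj : (~` V j) M)) => N Nj /=.
    by rewrite (asboolF JM) asboolF // => JN; exact/Nj/JN.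
  have : iprod J B a by rewrite JB; exact: pidealx.
  move=> [l [lP e]].
  have near_l : onear M [set N | forall p, List.In p l -> sval N p.1].
    elim: l lP {e} => [|p l IH] lP; first by apply: onearT => N p [].
    have Jp : sval M p.1 by apply: JM; case: (lP p) => //; left.
    have {}IH := IH (fun q ql => lP q (or_intror ql)).
    by apply: onearS2 (open_onear (open_V p.1) Jp) IH => N Np Nl q [<-//|/Nl].
  apply: onearS near_l => N Nl /=; rewrite (asboolT JM) asboolT // => j Jj.
  have [[N0 ND NM] _ _] := MaxT_prime N.
  (* Writing [a] as the sum of the [p.1 * p.2] with [p.1] in [N], each [j * p.2] is a multiple
     [r * a], so [j * a] is [a] times an element of [N], and [a] cancels. *)
  suff [t [Nt et]] : exists t, sval N t /\ j * a = t * a by rewrite (mulIf a0 et).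
  rewrite [in j * a]e mulr_sumr; elim: l lP Nl {e} => [|p l IH] lP Nl.
    by exists 0; rewrite big_nil mul0r.
  have [|q ql|t [Nt et]] := IH; [by move=> q ql; apply: lP; right|by apply: Nl; right|].
  have [Jp Bp] := lP p (or_introl erefl).
  have : iprod J B (j * p.2) by exact: iprod_mem.
  rewrite JB => -[r er]; exists (p.1 * r + t).
  split; last by rewrite big_cons et mulrCA er; ring.
  by apply: ND => //; rewrite mulrC; apply: NM; apply: Nl; left.
elim: s lcJ {sI sR sE aJ} => [|J s IH] lcJ /=; first exact: lcst_cst.
apply: (lcst_op2 +%R); first by apply: lcJ; left.
by apply: IH => K Ks; apply: lcJ; right.
Qed.

Lemma lcst_v x : x != 0 -> lcst (fun M => v M x).
Proof.
move=> /fraction_repr_neq0[a [b [a0 b0 ->]]].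
have -> : (fun M => v M (tofrac a / tofrac b)) =
    (fun M => v M (tofrac a) - v M (tofrac b)).
  by apply/funext => M; rewrite v_mul ?invr_eq0 ?tofrac_eq0 // vV ?tofrac_eq0.
by apply: (lcst_op2 (fun m n => m - n)); exact: lcst_v_tofrac.
Qed.

Lemma v_support x : x != 0 -> exists a, a != 0 /\ forall M, ~ V a M -> v M x = 0.
Proof.
move=> /fraction_repr_neq0[a [b [a0 b0 ->]]]; exists (a * b).
rewrite mulf_neq0 //; split=> // M Mab; have [_ _ MM] := MaxT_ideal M.
rewrite v_mul ?invr_eq0 ?tofrac_eq0 // vV ?tofrac_eq0 // !v_eq0 // => Mc; apply: Mab.
  by rewrite /V /=; exact: MM.
by rewrite /V /= mulrC; exact: MM.
Qed.

Lemma Cc_v x : x != 0 -> Cc (fun M => v M x).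
Proof.
move=> x0; apply/CcP; split; first exact: lcst_v.
have [a [a0 aP]] := v_support x0; exists (V a); split.
- exact: (compact_V hSP).
- exact: closed_V.
- by move=> M; apply: contra_neqP; exact: aP.
Qed.

(** An element [b] with value [n] at [M0] is good near [M0] and wherever both [f] is at most 0 and
    [b] has value 0. The remaining bad set is compact and misses [M0], so it is repaired by a power
    of some [c] that lies outside [M0] but in every bad [M]. *)
Lemma approximation (f : MaxT R -> int) M0 (n : int) (m : nat) C : compact C ->
  (forall M, f M <= m%:Z) -> (forall M, ~ C M -> f M <= 0) ->
  onear M0 [set M | f M <= n] ->
  exists x, [/\ x != 0, v M0 x = n & forall M, f M <= v M x].
Proof.
move=> cC fm fC fn; have [b [b0 vb]] := v_surj M0 n.
have [a [a0 aP]] := v_support b0; have [k kP] := Cc_bounded (Cc_v b0).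
have [U [oU UM0 Uf]] : onear M0 [set M | f M <= v M b].
  by apply: onearS2 fn (lcst_v b0 M0) => M /=; rewrite vb => ? ->.
have cC' : compact ((C `|` V a) `&` ~` U).
  by apply: compact_closedI; [apply: compactU => //; exact: (compact_V hSP)|exact: open_closedC].
have [|c [Mc cP]] := @compact_sub_avoiding_V R _ M0 cC'; first by move=> [_].
have c0 := notin_neq0 Mc; have fc0 := tofrac_neq0 c0.
(* On the bad set [c] has value at least 1, so the exponent outweighs [f], at most [m], and the
   value of [b], at least [-k]. *)
exists (b * tofrac c ^+ (m + k)); rewrite mulf_neq0 ?expf_neq0 //; split=> //.
  by rewrite v_mul ?expf_neq0 // vX // v_eq0 // mul0rn addr0.
move=> M; rewrite v_mul ?expf_neq0 // vX //.
have [bad|good] := pselect (((C `|` V a) `&` ~` U) M).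
  have := v_gt0 c0 (cP _ bad); have := fm M; have := kP M.
  by rewrite -mulr_natr; nia.
have vc := v_ge0 M c0; suff : f M <= v M b by rewrite -mulr_natr; nia.
have [UM|UM] := pselect (U M); first exact: Uf.
have nCa : ~ (C `|` V a) M by move=> H; apply: good.
by rewrite aP; [apply: fC => CM; apply: nCa; left|move=> aM; apply: nCa; right].
Qed.

(** Zero is put in by hand, since a valuation is specified on nonzero elements only. *)
Definition videal (f : MaxT R -> int) : set K :=
  [set x | x = 0 \/ forall M, f M <= v M x].

(** A nonzero [a] lying in every [M] of [C] has [a ^+ m] of value at least [m] on [C] and at least 0
    elsewhere. This power is at once a member of the ideal and a common denominator for it. *)
Lemma videal_frac f (m : nat) C : compact C -> (forall M, (`|f M| <= m)%N) ->
  (forall M, ~ C M -> f M = 0) -> is_frac_ideal (videal f).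
Proof.
move=> cC fm fC; have [a [a0 Ca]] := compact_sub_nonzero_V hnf cC.
have fa0 := tofrac_neq0 a0.
have va M : C M -> m%:Z <= v M (tofrac a ^+ m).
  by move=> /Ca Ma; have := v_gt0 a0 Ma; rewrite vX // -mulr_natr; nia.
have va0 M : 0 <= v M (tofrac a ^+ m) by rewrite vX // mulrn_wge0 // v_ge0.
split.
- by left.
- move=> x y [->|fx] [->|fy]; rewrite ?add0r ?addr0; try by [left|right].
  have [|xy0] := eqVneq (x + y) 0; first by left.
  right=> M; have := @vgeD _ (v M) (@v_add M) (f M) x y; rewrite /vge xy0; apply=> // _.
- move=> r x [->|fx]; first by rewrite mulr0; left.
  have [->|x0] := eqVneq x 0; first by rewrite mulr0; left.
  have [->|r0] := eqVneq r 0; first by rewrite tofrac0 mul0r; left.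
  right=> M; rewrite v_mul ?tofrac_eq0 //; have := fx M; have := v_ge0 M r0; lia.
- exists (a ^+ m); split; first exact: expf_neq0.
  move=> x [->|fx]; first by exists 0; rewrite mulr0 tofrac0.
  have [->|x0] := eqVneq x 0; first by exists 0; rewrite mulr0 tofrac0.
  rewrite tofracXn; apply: RsetP => [|M]; first by rewrite mulf_neq0 ?expf_neq0.
  rewrite v_mul ?expf_neq0 //; have := fx M; have := fm M; have := va0 M.
  have [/va|/fC ->] := pselect (C M); lia.
- exists (tofrac a ^+ m); rewrite expf_neq0 //; split=> //; right=> M.
  have [/va|/fC ->//] := pselect (C M); have := fm M; lia.
Qed.

Lemma nu_videal f (m : nat) C M0 : compact C -> (forall M, (`|f M| <= m)%N) ->
  (forall M, ~ C M -> f M = 0) -> onear M0 [set M | f M <= f M0] ->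
  nuM (videal f) M0 = f M0.
Proof.
move=> cC fm fC fn; apply: nuE; first exact: videal_frac fm fC.
split; last by move=> i [->|//]; rewrite eqxx.
have [M||x [x0 vx fx]] := @approximation f M0 (f M0) m C cC _ _ fn.
- by have := fm M; lia.
- by move=> M /fC ->.
- by exists x; split=> //; right.
Qed.

(** * Semicontinuity, local constancy and invertibility *)

Lemma nu_bounded I : is_frac_ideal I -> exists (m : nat) (a : R),
  [/\ a != 0, forall M, (`|nuM I M| <= m)%N & forall M, ~ V a M -> nuM I M = 0].
Proof.
move=> fI; have [d [d0 dI]] := frac_ideal_bounded fI.
have [_ _ _ _ [x [Ix x0]]] := fI; have fd0 := tofrac_neq0 d0.
have [m1 m1P] := Cc_bounded (Cc_v fd0); have [m2 m2P] := Cc_bounded (Cc_v x0).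
have [a [a0 aP]] := v_support fd0; have [b [b0 bP]] := v_support x0.
have lb M : - v M (tofrac d) <= nuM I M.
  by have [i [Ii i0 <-]] := nu_attained M fI; exact: dI.
exists (m1 + m2)%N, (a * b); split; first exact: mulf_neq0.
  by move=> M; have := lb M; have := nu_le M fI Ix x0; have := m1P M; have := m2P M; lia.
move=> M Mab; have [_ _ MM] := MaxT_ideal M.
have := lb M; have := nu_le M fI Ix x0; rewrite aP ?bP; first by lia.
  by move=> Mb; apply: Mab; rewrite /V /=; exact: MM.
by move=> Ma; apply: Mab; rewrite /V /= mulrC; exact: MM.
Qed.

(** An element attaining the minimum at [M0] keeps its value nearby, so the minimum cannot jump
    up. *)
Lemma nu_usc I M0 : is_frac_ideal I -> onear M0 [set M | nuM I M <= nuM I M0].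
Proof.
move=> fI; have [i [Ii i0 <-]] := nu_attained M0 fI.
by apply: onearS (lcst_v i0 M0) => M <-; exact: nu_le.
Qed.

(** [(R : I)] is the ideal with prescribed values [- nuM I]. The prescription is attained at [M0]
    provided [- nuM I] does not exceed its value at [M0] nearby, which is opposite to [nu_usc];
    hence the assumption of local constancy. *)
Lemma nu_colon I M0 : is_frac_ideal I ->
  onear M0 [set M | nuM I M = nuM I M0] ->
  nuM (colon (@Rset R) I) M0 = - nuM I M0.
Proof.
move=> fI lcI; have [m [a [a0 bd supp]]] := nu_bounded fI.
have -> : colon (@Rset R) I = videal (fun M => - nuM I M).
  apply/seteqP; split=> x.
    by have [->|x0] := eqVneq x 0; [left|move=> /(colonP fI x0); right].
  have [->|x0] := eqVneq x 0; first by case: (colon_frac fI).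
  by move=> [x0'|xP]; [rewrite x0' eqxx in x0|exact/(colonP fI x0)].
apply: (@nu_videal _ m (V a)).
- exact: (compact_V hSP).
- by move=> M; rewrite abszN.
- by move=> M /supp ->; rewrite oppr0.
- by apply: onearS lcI => M /= ->.
Qed.

(** [nuM I] and the function of the inverse sum to 0 and are semicontinuous in the same direction,
    so neither can drop. *)
Lemma invertible_lcst I : invertible I -> lcst (nuM I).
Proof.
move=> [fI inv] M0; have fJ := colon_frac fI.
have e M : nuM I M + nuM (colon (@Rset R) I) M = 0.
  by rewrite -[LHS]/((fun M => nuM I M + nuM (colon (@Rset R) I) M) M) -nu_iprod // inv nu_Rset.
apply: onearS2 (nu_usc M0 fI) (nu_usc M0 fJ) => M /=; have := e M; have := e M0; lia.
Qed.

Lemma lcst_invertible I : is_frac_ideal I -> lcst (nuM I) -> invertible I.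
Proof.
move=> fI lI; split=> //; apply: nu_inj.
- by apply: iprod_frac => //; exact: colon_frac.
- exact: Rset_frac.
- rewrite nu_iprod //; last exact: colon_frac.
  by apply/funext => M; rewrite nu_Rset nu_colon // subrr.
Qed.

Lemma invertible_Cc I : invertible I -> Cc (nuM I).
Proof.
move=> iI; have [fI _] := iI; apply/CcP; split; first exact: invertible_lcst.
have [m [a [a0 _ supp]]] := nu_bounded fI; exists (V a); split.
- exact: (compact_V hSP).
- exact: closed_V.
- by move=> M; apply: contra_neqP; exact: supp.
Qed.

Lemma Cc_invertible f : Cc f -> exists I, invertible I /\ nuM I = f.
Proof.
move=> cf; have [m fm] := Cc_bounded cf; move/CcP: cf => [lf [C [cC _ fC]]].
have fC' M : ~ C M -> f M = 0 by move=> CM; apply/eqP; apply: contra_notT CM; exact: fC.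
have e : nuM (videal f) = f.
  apply/funext => M; apply: nu_videal fm fC' _ => //.
  by apply: onearS (lf M) => N /= ->.
exists (videal f); split=> //; apply: lcst_invertible; last by rewrite e.
exact: videal_frac fm fC'.
Qed.

End FractionalIdeals.

(** * Irreducible perfect maps *)

Section GleasonCover.
Variables (X E : topologicalType) (j : E -> X).
Hypothesis hj : gleason_cover j.

Lemma gleason_surj x : exists e, j e = x.
Proof. by case: hj => _ []. Qed.

(** [U] consists of the points whose whole fibre lies in [W]. It is open as [j] is closed; were it
    empty, the complement of [W] would be a closed set mapping onto [X]. *)
Lemma gleason_irreducible (W : set E) : open W -> W !=set0 ->
  exists U, [/\ open U, U !=set0 & forall e, U (j e) -> W e].
Proof.
case: hj => -[_ _ _ clj _] [_ irr] oW [e0 We0]; exists (~` (j @` (~` W))); split.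
- by apply: closed_openC; apply: clj; exact: open_closedC.
- apply: contrapT => n0; have : ~` W = setT.
    apply: irr; first exact: open_closedC.
    apply/seteqP; split=> // x _; apply: contrapT => nx; apply: n0; by exists x.
  by move=> WT; have : (~` W) e0 by rewrite WT.
- by move=> e Uje; apply: contrapT => We; apply: Uje; exists e.
Qed.

Lemma gleason_dense (U : set X) (W : set E) : dense U -> open W -> W !=set0 ->
  exists e, W e /\ U (j e).
Proof.
move=> dU oW /(gleason_irreducible oW)[B [oO nO OW]].
have [x [Ox Ux]] := dU _ nO oO; have [e ex] := gleason_surj x.
by exists e; rewrite ex; split=> //; apply: OW; rewrite ex.
Qed.

Lemma gleason_continuous : continuous j.
Proof. by case: hj => -[]. Qed.

Lemma gleason_open_preimage (U : set X) : open U -> open (j @^-1` U).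
Proof. by move: U; apply/continuousP; exact: gleason_continuous. Qed.

(* An ultrafilter on [j @^-1` C] accumulates nowhere on the fibre of the limit of
   its image only if it omits a neighbourhood of that compact fibre, which contains
   the preimage of a neighbourhood of the limit since [j] is closed. *)
Lemma gleason_compact_preimage (C : set X) : compact C -> compact (j @^-1` C).
Proof.
move=> cC; rewrite compact_ultra => F UF FC.
have PF : ProperFilter (j @ F) by exact: fmap_proper_filter.
have [x [Cx clx]] := cC (j @ F) PF FC.
case: hj => -[_ _ _ clj cpt] _.
have : j @^-1` [set x] `&` [set p | F --> p] !=set0; last first.
  by move=> [p [jp Fp]]; exists p; split=> //; rewrite /preimage /= jp.
apply: contrapT => n0.
have [|e /= je|s sP] := @compact_list_cover E _ {W : set E | open W /\ F (~` W)}
  (fun W => sval W) (cpt x).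
- by move=> W; case: (svalP W).
- have : ~ (F --> e) by move=> Fe; apply: n0; exists e.
  move=> nFe; apply: contrapT => nW; apply: nFe => A; rewrite nbhsE => -[B [oB Be] BA].
  have [FB|FB] := in_ultra_setVsetC B UF; first exact: filterS FB.
  by case: nW; exists (exist _ B (conj oB FB)).
pose W := [set e | exists i : {W : set E | open W /\ F (~` W)}, List.In i s /\ sval i e].
have oW : open W.
  apply: open_local => e [i [si ie]]; exists (sval i); split=> //.
    by case: (svalP i).
  by move=> e' ie'; exists i.
have FW : F (~` W).
  have : F [set e | forall i : {W : set E | open W /\ F (~` W)}, List.In i s -> ~ sval i e].
    elim: s {sP W oW} => [|i s IH]; first by apply: filterS filterT => e _ i [].
    have Fi : F (~` sval i) by case: (svalP i).
    by apply: filterS2 Fi IH => e ei es k [<-|/es].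
  by apply: filterS => e He [i [si ie]]; exact: (He i).
pose U := ~` (j @` (~` W)).
have oU : open U by apply: closed_openC; apply: clj; exact: open_closedC.
have Ux : U x by move=> [e We je]; apply: We; exact: sP.
have [_ [[e We <-] Uje]] := clx (j @` (~` W)) U
  (filterS (@preimage_image _ _ j (~` W)) FW) (open_nbhs_nbhs (conj oU Ux)).
by apply: Uje; exists e.
Qed.

Lemma gleason_eq (U : set X) (g h : E -> int) : dense U -> lcst g -> lcst h ->
  (forall e, U (j e) -> g e = h e) -> g = h.
Proof.
move=> dU lg lh gh; apply/funext => e; apply: contrapT => ne.
have [||e' [ne' Ue']] := @gleason_dense U [set e | g e - h e <> 0] dU.
- have /lcstP := lcst_op2 (fun m n => m - n) lg lh.
  by move=> /(_ [set n | n <> 0]).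
- by exists e => /= /eqP; rewrite subr_eq0 => /eqP.
- by apply: ne'; rewrite gh // subrr.
Qed.

(* In an extremally disconnected space disjoint open sets have disjoint closures,
   which are open. *)
Lemma gleason_extension (U : set X) (u : X -> int) (m : nat) : dense U ->
  (forall x, U x -> onear x [set y | U y /\ u y = u x]) ->
  (forall x, (`|u x| <= m)%N) ->
  exists g : E -> int, lcst g /\ forall e, U (j e) -> g e = u (j e).
Proof.
move=> dU lu um; case: (hj) => -[_ ed _ _ _] _.
pose A n := [set e | U (j e) /\ u (j e) = n].
have oA n : open (A n).
  apply: open_local => e [Ue ue]; have [W [oW We WU]] := lu _ Ue.
  exists (j @^-1` W); split=> //; first exact: gleason_open_preimage.
  by move=> e' /WU[Ue' ue']; split=> //; rewrite ue' ue.
have disj (B C : set E) : open B -> open C -> B `&` C `<=` set0 -> B `&` closure C `<=` set0.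
  move=> oB oC BC0 e [Be clC].
  by have [e' [Ce' Be']] := clC B (open_nbhs_nbhs (conj oB Be)); apply: (BC0 e').
have disjA n k e : closure (A n) e -> closure (A k) e -> n = k.
  move=> An Ak; apply: contrapT => nk.
  apply: (disj (closure (A k)) (A n) _ _ _ e) => //; first exact: ed.
  rewrite setIC; apply: disj => // e' [[_ en] [_ ek]].
  by apply: nk; rewrite -en -ek.
(* Boundedness of [u] leaves finitely many [A n], so the closure of their dense union is the union
   of their closures. *)
have cover e : exists n, closure (A n) e.
  pose s := [seq k%:Z - m%:Z | k <- iota 0 (m + m).+1].
  have : closure [set e | U (j e) /\ u (j e) \in s] e.
    move=> W; rewrite nbhsE => -[W' [oW' W'e] W'W].
    have [|e' [We' Ue']] := gleason_dense dU oW'; first by exists e.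
    exists e'; split; last exact: W'W.
    split=> //; apply/mapP; exists `|(u (j e') + m%:Z)%R|%N; have := um (j e').
      by rewrite mem_iota; lia.
    by lia.
  elim: s => [|n s IH].
    by rewrite (_ : [set _ | _] = set0) ?closure0 //; apply/seteqP; split=> // ? [].
  rewrite (_ : [set _ | _] = A n `|` [set e | U (j e) /\ u (j e) \in s]).
    by rewrite closureU => -[An|/IH//]; exists n.
  apply/seteqP; split=> e' /=.
    by move=> [Ue']; rewrite inE => /orP[/eqP|]; [left|right].
  by move=> [[Ue' ->]|[Ue' us]]; rewrite inE ?eqxx ?us ?orbT.
pose g e := projT1 (cid (cover e)).
have gP n e : closure (A n) e -> g e = n.
  by move=> An; apply: disjA An; exact: projT2 (cid (cover e)).
exists g; split; last by move=> e Ue; apply: gP; exact: subset_closure.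
move=> e; exists (closure (A (g e))); split.
- exact: ed.
- exact: projT2 (cid (cover e)).
- by move=> e' /gP.
Qed.

End GleasonCover.

Lemma dense_openI (X : topologicalType) (U W : set X) : open U -> dense U -> dense W ->
  dense (U `&` W).
Proof.
move=> oU dU dW B nO oO; have [x [Ox Ux]] := dU _ nO oO.
have [|y [[Oy Uy] Wy]] := dW (B `&` U) _ (openI oO oU); first by exists x.
by exists y.
Qed.

(** * Divisorial ideals and the Gleason cover *)

Section Divisorial.
Variable R : idomainType.
Hypotheses (hSP : SP_domain R) (hnf : not_field R).
Variables (E : topologicalType) (j : E -> MaxT R).
Hypothesis hj : gleason_cover j.
Local Notation K := {fraction R}.
Local Notation v M := (vM (sval M)).
Local Notation inv := (colon (@Rset R)).
Implicit Types (M N : MaxT R) (x y z : K) (I J D : set K) (g h : E -> int).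

Lemma subset_inv I J : I `<=` J -> inv J `<=` inv I.
Proof. by move=> IJ x Jx b /IJ; exact: Jx. Qed.

Lemma sub_inv_inv I : I `<=` inv (inv I).
Proof. by move=> x Ix b bI; rewrite mulrC; exact: bI. Qed.

Lemma divisorial_inv I : is_frac_ideal I -> divisorial (inv I).
Proof.
move=> fI; split; first exact: colon_frac.
apply/seteqP; split; last exact: sub_inv_inv.
by apply: subset_inv; exact: sub_inv_inv.
Qed.

Lemma divisorial_frac D : divisorial D -> is_frac_ideal D.
Proof. by case. Qed.

Lemma divisorial_dstar I J : divisorial I -> divisorial J -> divisorial (dstar I J).
Proof.
move=> [fI _] [fJ _]; apply: divisorial_inv; apply: (colon_frac).
exact: iprod_frac.
Qed.

Lemma invertible_divisorial I : invertible I -> divisorial I.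
Proof.
move=> [fI e]; split=> //; apply/seteqP; split; last exact: sub_inv_inv.
move=> x xI; have [I0 ID IM _ _] := fI.
suff : iprod I (inv I) `<=` [set y | I (x * y)].
  by move=> /(_ 1); rewrite /= mulr1; apply; rewrite e; exact: Rset1.
apply: iprod_sub => [|y z Iy Iz|i k Ii kI] /=.
- by rewrite mulr0.
- by rewrite mulrDr; exact: ID.
- by rewrite mulrCA; have [r ->] := xI _ kI; rewrite mulrC; exact: IM.
Qed.

Lemma invertible_Rset : invertible (@Rset R).
Proof.
apply: lcst_invertible => //; first exact: Rset_frac.
rewrite (_ : nuM _ = fun=> 0); first exact: lcst_cst.
by apply/funext => M; exact: nu_Rset.
Qed.

(** The dense open set is left existential so that sets for different ideals can be intersected. *)
Definition extends_nu I g := lcst g /\ exists U, [/\ open U, dense U &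
  forall e, U (j e) -> g e = nuM I (j e)].

(** Inside any nonempty open set choose a point where [nuM I] is smallest there: semicontinuity
    forbids larger values nearby and minimality forbids smaller ones. *)
Lemma nu_locally_constant_dense I : is_frac_ideal I ->
  dense [set M | onear M [set N | nuM I N = nuM I M]].
Proof.
move=> fI; have [m [a [_ bd _]]] := nu_bounded hSP hnf fI.
move=> B [M0 OM0] oO.
have ex : exists k : nat, `[< exists M, B M /\ nuM I M = k%:Z - m%:Z >].
  exists `|(nuM I M0 + m%:Z)%R|%N; apply/asboolP; exists M0; split=> //.
  by have := bd M0; lia.
case: (ex_minnP ex) => k /asboolP[M [OM eM]] kmin; exists M; split=> //.
apply: onearS2 (nu_usc hSP hnf M fI) (open_onear oO OM) => N /= le ON.
have := kmin `|(nuM I N + m%:Z)%R|%N.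
have -> : `[< exists M, B M /\ nuM I M = `|(nuM I N + m%:Z)%R|%N%:Z - m%:Z >].
  by apply/asboolP; exists N; split=> //; have := bd N; lia.
by move=> /(_ isT); have := bd N; lia.
Qed.

Lemma open_nu_locally_constant I : open [set M | onear M [set N | nuM I N = nuM I M]].
Proof.
apply: open_local => M [U [oU UM Uc]]; exists U; split=> // N UN.
by exists U; split=> // N' UN'; rewrite /= (Uc _ UN') (Uc _ UN).
Qed.

Lemma extends_nu_exists I : is_frac_ideal I -> exists g, extends_nu I g.
Proof.
move=> fI; have [m [a [_ bd _]]] := nu_bounded hSP hnf fI.
have oU := @open_nu_locally_constant I; have dU := nu_locally_constant_dense fI.
have [|g [lg gP]] := gleason_extension hj (u := nuM I) (m := m) dU _ bd.
  by move=> M UM; apply: onearS2 UM (open_onear oU UM) => N ? ?; split.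
by exists g; split=> //; eexists; split; [exact: oU|exact: dU|].
Qed.

Lemma extends_nu_Cc I g : is_frac_ideal I -> extends_nu I g -> Cc g.
Proof.
move=> fI [lg [U [oU dU gU]]]; apply/CcP; split=> //.
have [_ [a [a0 _ supp]]] := nu_bounded hSP hnf fI.
exists (j @^-1` V a); split.
- by apply: (gleason_compact_preimage hj); exact: (compact_V hSP).
- by move/continuous_closedP: (gleason_continuous hj); apply; exact: closed_V.
- move=> e ge; apply: contrapT => Ve.
  have [||e' [[ge' Ve'] Ue']] := gleason_dense hj (W := [set e | g e != 0] `&` j @^-1` (~` V a)) dU.
  + apply: openI; first by move/lcstP: lg => /(_ [set n | n != 0]).
    by apply: (gleason_open_preimage hj); exact: open_notV.
  + by exists e.
  + by move: ge'; rewrite /= gU // supp // eqxx.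
Qed.

Lemma extends_nu_eq I g h : extends_nu I g -> extends_nu I h -> g = h.
Proof.
move=> [lg [U [oU dU gU]]] [lh [W [oW dW hW]]].
apply: (gleason_eq hj (dense_openI oU dU dW)) => // e [Ue We].
by rewrite gU // hW.
Qed.

Lemma extends_nu_iprod I J g h : is_frac_ideal I -> is_frac_ideal J ->
  extends_nu I g -> extends_nu J h -> extends_nu (iprod I J) (fun e => g e + h e).
Proof.
move=> fI fJ [lg [U [oU dU gU]]] [lh [W [oW dW hW]]].
split; first exact: (lcst_op2 +%R).
exists (U `&` W); split; [exact: openI|exact: dense_openI|].
by move=> e [Ue We]; rewrite nu_iprod // gU // hW.
Qed.

Lemma extends_nu_inv I g : is_frac_ideal I -> extends_nu I g ->
  extends_nu (inv I) (fun e => - g e).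
Proof.
move=> fI [lg [U [oU dU gU]]]; have oW := @open_nu_locally_constant I.
split; first exact: (lcst_op2 (fun m _ => - m) lg lg).
exists (U `&` [set M | onear M [set N | nuM I N = nuM I M]]); split.
- exact: openI.
- by apply: dense_openI => //; exact: nu_locally_constant_dense.
- by move=> e [Ue We]; rewrite nu_colon // gU.
Qed.

Lemma extends_nu_inv_inv I g : is_frac_ideal I -> extends_nu I g ->
  extends_nu (inv (inv I)) g.
Proof.
move=> fI Ig; have fJ := colon_frac fI.
have := extends_nu_inv fJ (extends_nu_inv fI Ig).
by under eq_fun do rewrite opprK.
Qed.

Lemma extends_nu_invertible I : invertible I -> extends_nu I (nuM I \o j).
Proof.
move=> iI; split.
  by apply: lcst_comp; [exact: (gleason_continuous hj)|exact: invertible_lcst].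
exists setT; split=> //; first exact: openT.
by move=> B [x Ox] _; exists x.
Qed.

(** For [x] in [D] and [y] in [(R : D')], the set where [x * y] has negative value is open. If
    nonempty it would meet the dense set where [g] computes both functions, and there the values of
    [x] and [y] are at least [g] and [- g]. So [x] lies in the double inverse of [D'], which is
    [D']. *)
Lemma extends_nu_sub D D' g : divisorial D -> divisorial D' ->
  extends_nu D g -> extends_nu D' g -> D `<=` D'.
Proof.
move=> [fD _] [fD' eD'] [_ [U [oU dU gU]]] [_ [W [oW dW hW]]] x Dx.
rewrite -eD' => y yD'.
have [->|x0] := eqVneq x 0; first by rewrite mul0r; case: (Rset_frac R).
have [->|y0] := eqVneq y 0; first by rewrite mulr0; case: (Rset_frac R).
have xy0 := mulf_neq0 x0 y0; apply: RsetP => // M; rewrite leNgt; apply/negP => lt0.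
have [||N [Nlt [UN WN]]] := @dense_openI _ U W oU dU dW [set N | v N (x * y) < 0].
- by exists M.
- by have /lcstP/(_ [set n | n < 0]) := lcst_v hSP hnf xy0.
have [e eN] := gleason_surj hj N; move: Nlt; rewrite /= v_mul //.
have := nu_le hSP hnf N fD Dx x0; have /(colonP hSP hnf fD' y0)/(_ N) := yD'.
by rewrite -eN in UN WN *; rewrite -gU // -hW //; lia.
Qed.

Lemma extends_nu_inj D D' g : divisorial D -> divisorial D' ->
  extends_nu D g -> extends_nu D' g -> D = D'.
Proof.
by move=> dD dD' Dg D'g; apply/seteqP; split; apply: extends_nu_sub; eassumption.
Qed.

Lemma fibre_max_exists g (m : nat) : (forall e, (`|g e| <= m)%N) -> forall M,
  exists n, (exists e, j e = M /\ g e = n) /\ forall e, j e = M -> g e <= n.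
Proof.
move=> gm M; have [e0 je0] := gleason_surj hj M.
have ex : exists k : nat, `[< exists e, j e = M /\ g e = m%:Z - k%:Z >].
  by exists `|m%:Z - g e0|%N; apply/asboolP; exists e0; split=> //; have := gm e0; lia.
case: (ex_minnP ex) => k /asboolP[e [je ge]] kmin; exists (m%:Z - k%:Z); split.
  by exists e.
move=> e' je'; have := kmin `|m%:Z - g e'|%N.
have -> : `[< exists e, j e = M /\ g e = m%:Z - `|m%:Z - g e'|%N%:Z >].
  by apply/asboolP; exists e'; split=> //; have := gm e'; lia.
by move=> /(_ isT); have := gm e'; lia.
Qed.

(** The points near which [g] takes a single value on all fibres are dense by irreducibility, and
    there the fibrewise maximum [f] is locally constant, hence attained by [videal f]. Passing to
    the double inverse makes the ideal divisorial and keeps the extension. *)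
Lemma extends_nu_surj g : Cc g -> exists D, divisorial D /\ extends_nu D g.
Proof.
move=> cg; have [m gm] := Cc_bounded cg; move/CcP: cg => [lg [C [cC _ gC]]].
pose f M := projT1 (cid (fibre_max_exists gm M)).
have fP M : (exists e, j e = M /\ g e = f M) /\ forall e, j e = M -> g e <= f M.
  exact: projT2 (cid (fibre_max_exists gm M)).
have fm M : (`|f M| <= m)%N by have [[e [_ <-]] _] := fP M.
have cjC : compact (j @` C).
  apply: continuous_compact => //; apply: continuous_subspaceT.
  exact: gleason_continuous.
have fC M : ~ (j @` C) M -> f M = 0.
  have [[e [je <-]] _] := fP M; move=> nC; apply/eqP; apply: contra_notT nC => /gC Ce.
  by exists e.
suff [I [fI Ig]] : exists I, is_frac_ideal I /\ extends_nu I g.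
  exists (inv (inv I)); split; last exact: extends_nu_inv_inv.
  by apply: divisorial_inv; exact: colon_frac.
exists (videal f); split; first exact: (videal_frac hSP hnf cjC fm fC).
split=> //; exists [set M | exists n, onear M [set N | forall e, j e = N -> g e = n]]; split.
- apply: open_local => M [n [U [oU UM Un]]]; exists U; split=> // N UN.
  by exists n, U.
- move=> B [M OM] oO; have [e0 je0] := gleason_surj hj M.
  have [||U [oU [N UN] UW]] := gleason_irreducible hj (W := (j @^-1` B) `&` [set e | g e = g e0]).
  + apply: openI; first exact: gleason_open_preimage.
    by move/lcstP: lg => /(_ [set g e0]).
  + by exists e0; split=> //; rewrite /preimage /= je0.
  exists N; have [e je] := gleason_surj hj N; split.
    by have [] := UW e; rewrite ?je // /preimage /= je.
  exists (g e0), U; split=> // N' UN' e' je'.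
  by have [] := UW e'; rewrite ?je'.
- move=> e [n [U [oU Ue Un]]]; have gn : g e = n by exact: (Un _ Ue).
  have fU N : U N -> f N = n.
    by move=> UN; have [[e' [je' <-]] _] := fP N; exact: (Un _ UN).
  rewrite (nu_videal hSP hnf (m := m) (C := j @` C)) ?fU //.
  by exists U; split=> // N UN; rewrite /= !fU.
Qed.

(** * The isomorphism onto the functions on the cover *)

Definition beta D : E -> int := xget (fun=> 0) [set g | extends_nu D g].

Lemma betaP D : is_frac_ideal D -> extends_nu D (beta D).
Proof. by move=> fD; apply: xgetPex; exact: extends_nu_exists. Qed.

Lemma betaE D g : is_frac_ideal D -> extends_nu D g -> beta D = g.
Proof. by move=> fD Dg; apply: extends_nu_eq Dg; exact: betaP. Qed.

Lemma beta_Cc D : divisorial D -> Cc (beta D).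
Proof. by move=> [fD _]; apply: extends_nu_Cc (betaP fD). Qed.

Lemma beta_dstar D D' : divisorial D -> divisorial D' ->
  beta (dstar D D') = (fun e => beta D e + beta D' e).
Proof.
move=> dD dD'; have [fD _] := dD; have [fD' _] := dD'.
apply: betaE; first exact: divisorial_frac (divisorial_dstar dD dD').
apply: extends_nu_inv_inv; first exact: iprod_frac.
by apply: extends_nu_iprod => //; exact: betaP.
Qed.

Lemma beta_inv D : divisorial D -> beta (inv D) = (fun e => - beta D e).
Proof.
move=> [fD _]; apply: betaE; first exact: colon_frac.
by apply: extends_nu_inv => //; exact: betaP.
Qed.

Lemma beta_inj D D' : divisorial D -> divisorial D' -> beta D = beta D' -> D = D'.
Proof.
move=> dD dD' e; apply: (@extends_nu_inj _ _ (beta D)) => //.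
  by apply: betaP; exact: divisorial_frac.
by rewrite e; apply: betaP; exact: divisorial_frac.
Qed.

Lemma beta_surj g : Cc g -> exists D, divisorial D /\ beta D = g.
Proof.
move=> /extends_nu_surj[D [dD Dg]]; exists D; split=> //.
by apply: betaE => //; exact: divisorial_frac.
Qed.

Lemma beta_invertible I : invertible I -> beta I = nuM I \o j.
Proof. by move=> iI; apply: betaE; [case: iI|exact: extends_nu_invertible]. Qed.

End Divisorial.

(** * Free quotients of abelian groups *)

Section FreeQuotients.
Variable V : zmodType.
Implicit Types (G H K L P : set V) (s : seq V) (n : V -> int).

Definition is_subgroup P := P 0 /\ forall x y, P x -> P y -> P (x - y).

Definition lcomb s n := \sum_(b <- s) b *~ n b.

(** Freeness of [G / H] with basis the classes of [B]. Generation is phrased through subgroups, so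
    that it can be proved by induction along a filtration without handling explicit combinations. *)
Definition freemod G H := exists B : set V, [/\ B `<=` G,
  forall P, is_subgroup P -> H `<=` P -> B `<=` P -> G `<=` P &
  forall s n, uniq s -> (forall b, b \in s -> B b) -> H (lcomb s n) ->
    forall b, b \in s -> n b = 0].

Lemma subgroupN P x : is_subgroup P -> P x -> P (- x).
Proof. by move=> [P0 PB] Px; rewrite -sub0r; exact: PB. Qed.

Lemma subgroupD P x y : is_subgroup P -> P x -> P y -> P (x + y).
Proof. by move=> sP Px Py; rewrite -(opprK y); apply: sP.2 => //; exact: subgroupN. Qed.

Lemma subgroupMz P x k : is_subgroup P -> P x -> P (x *~ k).
Proof.
move=> sP Px; have PX m : P (x *+ m).
  elim: m => [|m IH]; first by rewrite mulr0n; case: sP.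
  by rewrite mulrS; exact: subgroupD.
case: k => m; first exact: PX.
by rewrite NegzE mulrNz; apply: subgroupN => //; exact: PX.
Qed.

Lemma subgroup_lcomb P s n : is_subgroup P -> (forall b, b \in s -> n b != 0 -> P b) ->
  P (lcomb s n).
Proof.
move=> sP sPb; rewrite /lcomb big_seq; apply: (big_ind (fun x => P x)).
- by case: sP.
- by move=> x y; exact: subgroupD.
- move=> b bs; have [->|nb] := eqVneq (n b) 0; first by rewrite mulr0z; case: sP.
  by apply: subgroupMz => //; exact: sPb.
Qed.

Lemma list_max (T : Type) (lt : T -> T -> Prop) (A : eqType) (f : A -> T) (s : seq A) (a : A) :
  (forall u t : T, lt u t \/ u = t \/ lt t u) ->
  (forall r u t : T, lt r u -> lt u t -> lt r t) -> a \in s ->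
  exists2 b, b \in s & forall c, c \in s -> lt (f c) (f b) \/ f c = f b.
Proof.
move=> tot tr; elim: s a => [//|x s IH] a _.
case: s IH => [|y s] IH.
  by exists x; rewrite ?mem_head // => c; rewrite inE => /eqP ->; right.
have [b bs bmax] := IH y (mem_head _ _).
have [xb|bx] : (lt (f x) (f b) \/ f x = f b) \/ lt (f b) (f x).
  by have [|[]] := tot (f x) (f b); tauto.
  exists b; first by rewrite inE bs orbT.
  by move=> c; rewrite inE => /orP[/eqP ->//|/bmax].
exists x; first exact: mem_head.
move=> c; rewrite inE => /orP[/eqP ->|/bmax[cb|->]]; [by right|left|by left].
exact: tr cb bx.
Qed.

(** In this filtration of [G] above [H], stage [t] leads from [L t] to [U t], and [L t] is exhausted
    by [H] and the earlier stages. Bases of the successive quotients combine: in a relation, the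
    terms below the largest index with a nonzero coefficient lie in [L] of that index, so the top
    terms form a relation in one quotient. *)
Lemma freemod_chain (T : Type) (lt : T -> T -> Prop) (D : set T) (L U : T -> set V) G H :
  well_founded lt -> (forall u t : T, lt u t \/ u = t \/ lt t u) ->
  (forall r u t : T, lt r u -> lt u t -> lt r t) ->
  (forall t, D t -> is_subgroup (L t)) ->
  (forall t, D t -> H `<=` L t) -> (forall t, D t -> U t `<=` G) ->
  (forall u t : T, D u -> D t -> lt u t -> U u `<=` L t) ->
  (forall x, G x -> H x \/ exists2 t, D t & U t x) ->
  (forall t x, D t -> L t x -> H x \/ exists u : T, [/\ D u, lt u t & U u x]) ->
  (forall t, D t -> freemod (U t) (L t)) -> freemod G H.
Proof.
move=> wf tot tr sL HL UG UL GU LU free.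
have /choice[B BP] : forall t, exists B : set V, D t -> [/\ B `<=` U t,
  forall P, is_subgroup P -> L t `<=` P -> B `<=` P -> U t `<=` P &
  forall s n, uniq s -> (forall b, b \in s -> B b) -> L t (lcomb s n) ->
    forall b, b \in s -> n b = 0].
  by move=> t; have [Dt|nDt] := pselect (D t); [have [Bt ?] := free _ Dt; exists Bt|exists set0].
exists [set b | exists2 t, D t & B t b]; split.
- by move=> b [t Dt Bb]; apply: (UG t) => //; have [BU _ _] := BP _ Dt; exact: BU.
- move=> P sP HP BPsub.
  have UP t : D t -> U t `<=` P.
    elim/(well_founded_ind wf): t => t IH Dt.
    have [_ gen _] := BP _ Dt; apply: gen => //; last by move=> b Bb; apply: BPsub; exists t.
    by move=> x /(LU _ _ Dt)[/HP//|[s [Ds st]]]; exact: IH.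
  by move=> x /GU[/HP//|[t Dt]]; exact: UP.
move=> s n us sB Hs b0 b0s; apply/eqP; apply: contrapT => /negP nb0.
have [t0 Dt0 _] := sB _ b0s.
have /choice[f fP] : forall b, exists t, b \in s -> D t /\ B t b.
  move=> b; have [bs|bs] := boolP (b \in s); last by exists t0.
  by have [t Dt Bb] := sB _ bs; exists t.
have [|b1] := @list_max T lt V f [seq b <- s | n b != 0] b0 tot tr.
  by rewrite mem_filter nb0.
rewrite mem_filter => /andP[nb1 b1s] b1max; have [Dt Bb1] := fP _ b1s.
have [_ _ ind] := BP _ Dt.
pose s1 := [seq b <- s | `[< f b = f b1 >]].
have /eqP : n b1 = 0; last by rewrite (negPf nb1).
apply: (ind s1 n); first exact: filter_uniq; last by rewrite mem_filter b1s asboolT.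
  by move=> b; rewrite mem_filter => /andP[/asboolP <- bs]; have [] := fP _ bs.
have -> : lcomb s1 n = lcomb s n - lcomb [seq b <- s | ~~ `[< f b = f b1 >]] n.
  by rewrite /lcomb !big_filter [in RHS](bigID (fun b => `[< f b = f b1 >])) /= addrK.
apply: (sL _ Dt).2; first exact: HL.
apply: subgroup_lcomb; first exact: sL.
move=> b; rewrite mem_filter => /andP[/asboolP fbt bs] nb.
have [Dfb Bfb] := fP _ bs; have [BU _ _] := BP _ Dfb.
apply: (UL (f b)) => //; last exact: BU.
by have [|//|] := b1max b; rewrite ?mem_filter ?nb ?bs.
Qed.

Lemma freemod_trans G K H : is_subgroup K -> is_subgroup H -> H `<=` K -> K `<=` G ->
  freemod G K -> freemod K H -> freemod G H.
Proof.
move=> sK sH HK KG fGK fKH.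
(* The two stages are indexed by [bool], with [false] below [true]. *)
apply: (@freemod_chain bool (fun a b => ~~ a && b) setT
  (fun b => if b then K else H) (fun b => if b then G else K)).
- have acc0 : Acc (fun a b => ~~ a && b) false by constructor; case.
  case; last exact: acc0.
  by constructor; case; last by move=> _; exact: acc0.
- by case; case; [right; left|right; right|left|right; left].
- by do 3 case.
- by case.
- by case=> _; [exact: HK|exact: subset_refl].
- by case=> _; [exact: subset_refl|exact: KG].
- by move=> [] [] _ _ //= _ x.
- by move=> x Gx; right; exists true.
- by case=> x _ /= xL; [right; exists false|left].
- by case.
Qed.

End FreeQuotients.

(** * Groups of integer-valued functions closed under composition *)

Section Specker.
Variable X : Type.
Local Notation V := (X -> int).
Implicit Types (f g a b : V) (A B L N S : set V).

(* The functions of finite range in such a group form the additive group of a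
   (possibly nonunital) ring generated by idempotents. *)
Definition specker L := [/\ L 0, forall f g, L f -> L g -> L (f + g) &
  forall (phi : int -> int) f, phi 0 = 0 -> L f -> L (phi \o f)].

Lemma specker_subgroup L : specker L -> is_subgroup L.
Proof.
move=> [L0 LD Lphi]; split=> // f g Lf Lg; apply: LD => //.
exact: (Lphi (fun z => - z)).
Qed.

(* 2 f g = (f + g)^2 - f^2 - g^2, and halving is a map fixing 0. *)
Lemma specker_mul L f g : specker L -> L f -> L g -> L (fun x => f x * g x).
Proof.
move=> sL Lf Lg; have [L0 LD Lphi] := sL; have [_ LB] := specker_subgroup sL.
pose sq (z : int) := z * z.
have -> : (fun x => f x * g x) = (fun z => (z %/ 2)%Z) \o ((sq \o (f + g)) - (sq \o f) - (sq \o g)).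
  apply/funext => x; rewrite /= /sq !fctE /=.
  rewrite (_ : _ - _ = 2 * (f x * g x)); last by ring.
  by rewrite mulKz.
apply: (Lphi); first by rewrite div0z.
by apply: (LB); [apply: (LB)|]; apply: Lphi => //; exact: LD.
Qed.

Lemma specker_scale L (c : int) f : specker L -> L f -> L (fun x => c * f x).
Proof. by move=> [_ _ Lphi] Lf; apply: (Lphi (fun z => c * z)); rewrite ?mulr0. Qed.

(** * Rings generated by idempotents and the adjunction of one more *)

Section Generation.
Variables (W : Type) (e : W -> V).
Hypothesis e01 : forall t x, e t x = 0 \/ e t x = 1.
Implicit Types (D : set W) (t u : W).

Inductive spk D : V -> Prop :=
| spk0 : spk D 0
| spk_gen t : D t -> spk D (e t)
| spk_add f g : spk D f -> spk D g -> spk D (f + g)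
| spk_comp (phi : int -> int) f : phi 0 = 0 -> spk D f -> spk D (phi \o f).

(** The unital version. Adjoining [e t] to [spk D] brings in the products [e t * b], and [e t]
    itself must be among them. *)
Definition spk1 D : set V := [set f | exists c : int, spk D (f - cst c)].

Lemma spk_specker D : specker (spk D).
Proof. by split; [exact: spk0|exact: spk_add|exact: spk_comp]. Qed.

Lemma spkS D D' : D `<=` D' -> spk D `<=` spk D'.
Proof.
move=> DD' f; elim=> [|t /DD' Dt|g h _ + _ +|phi g p0 _ +].
- exact: spk0.
- exact: spk_gen.
- exact: spk_add.
- exact: spk_comp.
Qed.

Lemma spk_min D L : specker L -> (forall t, D t -> L (e t)) -> spk D `<=` L.
Proof. by move=> [L0 LD Lphi] DL f; elim=> // *; [exact: LD|exact: Lphi]. Qed.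

Lemma spk1S D D' : D `<=` D' -> spk1 D `<=` spk1 D'.
Proof. by move=> DD' f [c fc]; exists c; exact: (spkS DD'). Qed.

Lemma spk_spk1 D : spk D `<=` spk1 D.
Proof. by move=> f Df; exists 0; rewrite subr0. Qed.

Lemma spk1_cst D c : spk1 D (cst c).
Proof. by exists c; rewrite subrr; exact: spk0. Qed.

Lemma spk1_add D f g : spk1 D f -> spk1 D g -> spk1 D (f + g).
Proof.
move=> [c fc] [d gd]; exists (c + d).
rewrite (_ : f + g - cst (c + d) = (f - cst c) + (g - cst d)); first exact: spk_add.
by apply/funext => x; rewrite !fctE /=; lia.
Qed.

Lemma spk1_comp D (phi : int -> int) f : spk1 D f -> spk1 D (phi \o f).
Proof.
move=> [c fc]; exists (phi c).
rewrite (_ : (phi \o f) - cst (phi c) =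
  (fun z => phi (z + c) - phi c) \o (f - cst c)).
  by apply: spk_comp => //; rewrite add0r subrr.
by apply/funext => x; rewrite !fctE /= subrK.
Qed.

Lemma spk1_specker D : specker (spk1 D).
Proof.
by split; [exact: spk1_cst|exact: spk1_add|move=> phi f _; exact: spk1_comp].
Qed.

Lemma spk1_mul_specker D L f g : specker L -> spk D `<=` L -> spk1 D f -> L g ->
  L (fun x => f x * g x).
Proof.
move=> sL DL [c fc] Lg; have [_ LD _] := sL.
rewrite (_ : (fun x => f x * g x) = (fun x => (f - cst c) x * g x) + (fun x => c * g x)).
  by apply: LD; [apply: specker_mul => //; exact: DL|exact: specker_scale].
by apply/funext => x; rewrite !fctE /=; ring.
Qed.

Definition adjoin t L S : set V :=
  [set f | exists a b, [/\ L a, S b & f = a + (fun x => e t x * b x)]].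

(** As [e t] takes only the values 0 and 1, composition acts separately on the two pieces. This is
    why sums [a + e t * b] already exhaust what [e t] generates. *)
Lemma adjoin_comp t a b (phi : int -> int) :
  phi \o (a + (fun x => e t x * b x)) =
  (phi \o a) + (fun x => e t x * ((phi \o (a + b)) - (phi \o a)) x).
Proof.
apply/funext => x; rewrite !fctE /=.
have [->|->] := e01 t x; first by rewrite !mul0r !addr0.
by rewrite !mul1r [RHS]addrC subrK.
Qed.

Lemma spk_adjoin D t : spk (D `|` [set t]) `<=` adjoin t (spk D) (spk1 D).
Proof.
move=> f; elim=> [|u [Du|->]|g h _ [a [b [Da Db ->]]] _ [c [d [Dc Dd ->]]]|
    phi g p0 _ [a [b [Da Db ->]]]].
- exists 0, 0; split; [exact: spk0|exact: spk1_cst|].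
  by apply/funext => x; rewrite !fctE /= mulr0.
- exists (e u), 0; split; [exact: spk_gen|exact: spk1_cst|].
  by apply/funext => x; rewrite !fctE /= mulr0 addr0.
- exists 0, (cst 1); split; [exact: spk0|exact: spk1_cst|].
  by apply/funext => x; rewrite !fctE /= mulr1 add0r.
- exists (a + c), (b + d); split; [exact: spk_add|exact: spk1_add|].
  by apply/funext => x; rewrite !fctE /=; ring.
- have [_ SB] := specker_subgroup (spk1_specker D); have Da1 := spk_spk1 Da.
  exists (phi \o a), ((phi \o (a + b)) - (phi \o a)); split.
  + exact: spk_comp.
  + by apply: SB; [apply: spk1_comp; exact: spk1_add|exact: spk1_comp].
  + exact: adjoin_comp.
Qed.

Lemma spk1_adjoin D t : spk1 (D `|` [set t]) `<=` adjoin t (spk1 D) (spk1 D).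
Proof.
move=> f [c /spk_adjoin[a [b [Da Db fE]]]]; exists (a + cst c), b; split=> //.
  by apply: spk1_add; [exact: spk_spk1|exact: spk1_cst].
by rewrite -(subrK (cst c) f) fE addrAC.
Qed.

Lemma adjoin_sub D t S : specker S -> spk (D `|` [set t]) `<=` S ->
  adjoin t S (spk1 D) `<=` S.
Proof.
move=> sS DS _ [a [b [Sa Db ->]]]; have [_ SD _] := sS; apply: SD => //.
rewrite (_ : (fun x => _) = (fun x => b x * e t x)); last by apply/funext => x; exact: mulrC.
apply: (@spk1_mul_specker (D `|` [set t])) => //.
  by apply: spk1S Db; left.
by apply: DS; apply: spk_gen; right.
Qed.

(** Stronger than a ring ideal: membership passes to smaller supports. In particular [g] is in [N]
    as soon as a nonzero multiple of it is, so the quotient is torsion-free. *)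
Definition spideal S N := [/\ N `<=` S, N 0, forall f g, N f -> N g -> N (f + g) &
  forall f g, N f -> S g -> (forall x, f x = 0 -> g x = 0) -> N g].

Lemma spideal_subgroup S N : specker S -> spideal S N -> is_subgroup N.
Proof.
move=> [_ _ Sphi] [NS N0 ND Nsupp]; split=> // f g Nf Ng; apply: ND => //.
apply: (Nsupp g) => //; first by apply: (Sphi (fun z => - z)); [rewrite oppr0|exact: NS].
by move=> x; rewrite !fctE /= => ->; rewrite oppr0.
Qed.

(** Multiplication by [e t] identifies the quotient of [spk1 D] by all [b] with [e t * b] in [L]
    with the new quotient, so a basis of the former is carried to one of the latter. *)
Lemma freemod_adjoin D t L : specker L -> spk D `<=` L ->
  (forall N, spideal (spk1 D) N -> freemod (spk1 D) N) ->
  freemod (adjoin t L (spk1 D)) L.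
Proof.
move=> sL DL free; have [L0 LD Lphi] := sL; have [_ LB] := specker_subgroup sL.
pose m b : V := fun x => e t x * b x.
have m0 : m 0 = 0 by apply/funext => x; exact: mulr0.
have mB a b : m (a - b) = m a - m b by apply/funext => x; exact: mulrBr.
have mD a b : m (a + b) = m a + m b by apply/funext => x; exact: mulrDr.
pose N : set V := [set b | spk1 D b /\ L (m b)].
have idN : spideal (spk1 D) N.
  split.
  - by move=> b [].
  - by split; [exact: spk1_cst|rewrite m0].
  - by move=> a b [Da La] [Db Lb]; split; [exact: spk1_add|rewrite mD; exact: LD].
  - move=> f g [Df Lf] Dg fg; split=> //.
    (* As [g] vanishes where [f] does, [e t * g] is [g] times the indicator of the support of
       [e t * f], and that indicator lies in [L]. *)
    rewrite (_ : m g = fun x => g x * ((fun z : int => (z != 0)%:Z) \o m f) x).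
      by apply: (spk1_mul_specker sL DL Dg); apply: Lphi.
    apply/funext => x; rewrite /m /=; have [->|->] := e01 t x.
      by rewrite !mul0r eqxx mulr0.
    rewrite !mul1r; have [/fg ->|_] := eqVneq (f x) 0; first by rewrite mulr0.
    by rewrite mulr1.
have [B [BD gen ind]] := free _ idN.
exists (m @` B); split.
- by move=> _ [b Bb <-]; exists 0, b; split=> //; [exact: BD|rewrite add0r].
- move=> P sP LP BP _ [a [b [La Db ->]]]; apply: subgroupD => //; first exact: LP.
  apply: (gen [set b | P (m b)]) Db.
  + by split; rewrite /= ?m0; [case: sP|move=> f g; rewrite /= mB; exact: sP.2].
  + by move=> f [_ /LP].
  + by move=> f Bf; apply: BP; exists f.
move=> s n us sB Ls c cs.
have /choice[f fP] : forall c : V, exists b : V, c \in s -> B b /\ m b = c.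
  move=> d; have [ds|ds] := boolP (d \in s); last by exists 0.
  by have [b Bb bd] := sB _ ds; exists b.
have -> : n c = (n \o m) (f c) by rewrite /= (fP _ cs).2.
apply: (ind [seq f c | c <- s]); last exact: map_f.
- rewrite map_inj_in_uniq // => x y xs ys /(congr1 m).
  by rewrite (fP _ xs).2 (fP _ ys).2.
- by move=> _ /mapP[d ds ->]; exact: (fP _ ds).1.
split.
  apply: subgroup_lcomb; first exact/specker_subgroup/spk1_specker.
  by move=> _ /mapP[d ds ->] _; apply: BD; exact: (fP _ ds).1.
rewrite (_ : m _ = lcomb s n) // /lcomb big_map.
have mz k b : m (b *~ k) = m b *~ k.
  have mX i a : m (a *+ i) = m a *+ i.
    by elim: i => [|i IH]; rewrite ?mulr0n // !mulrS mD IH.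
  have mN a : m (- a) = - m a by rewrite -sub0r mB m0 sub0r.
  by case: k => i; [exact: mX|rewrite NegzE !mulrNz mN; congr (- _); exact: mX].
rewrite (big_morph m mD m0) big_seq [RHS]big_seq; apply: eq_bigr => d ds.
by rewrite mz /= (fP _ ds).2.
Qed.

End Generation.
End Specker.

(** * Noebeling's theorem *)

Section WellOrderedGenerators.
Variables (X W : Type) (e : W -> X -> int) (lt : W -> W -> Prop).
Hypothesis e01 : forall t x, e t x = 0 \/ e t x = 1.
Hypothesis lt_wf : well_founded lt.
Hypothesis lt_total : forall u t, lt u t \/ u = t \/ lt t u.
Hypothesis lt_trans : forall r u t, lt r u -> lt u t -> lt r t.
Local Notation V := (X -> int).
Local Notation spk := (spk e).
Local Notation spk1 := (spk1 e).
Implicit Types (f g a b : V) (L N S : set V) (D : set W) (t u : W).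

Definition below t : set W := [set u | lt u t].

Definition down_closed D := forall u t, D t -> lt u t -> D u.

Lemma below_down_closed t : down_closed (below t).
Proof. by move=> u r rt ur; exact: lt_trans ur rt. Qed.

Lemma below_succ_sub D t : down_closed D -> D t -> below t `|` [set t] `<=` D.
Proof. by move=> dD Dt u [ut|->//]; exact: dD ut. Qed.

(** An element involves finitely many generators and so lives at the stage of the largest one; with
    no generator it is 0. *)
Lemma spk_bounded D f : down_closed D -> spk D f ->
  f = 0 \/ exists t, D t /\ spk (below t `|` [set t]) f.
Proof.
move=> dD; have mono u t : lt u t -> below u `|` [set u] `<=` below t `|` [set t].
  by move=> ut r [ru|->]; left => //; exact: lt_trans ru ut.
elim=> [|t Dt|g h _ [->|[u [Du ug]]] _ [->|[t [Dt th]]]|phi g p0 _ [->|[t [Dt tg]]]].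
- by left.
- by right; exists t; split=> //; apply: spk_gen; right.
- by left; rewrite addr0.
- by right; exists t; rewrite add0r.
- by right; exists u; rewrite addr0.
- right; have [ut|[eut|tu]] := lt_total u t.
  + by exists t; split=> //; apply: spk_add => //; exact: spkS (mono _ _ ut) _ ug.
  + by exists t; split=> //; apply: spk_add => //; rewrite -eut.
  + by exists u; split=> //; apply: spk_add => //; exact: spkS (mono _ _ tu) _ th.
- by left; apply/funext => x; exact: p0.
- by right; exists t; split=> //; exact: spk_comp.
Qed.

Lemma spk1_bounded D f : down_closed D -> spk1 D f ->
  (exists c, f = cst c) \/ exists t, D t /\ spk1 (below t `|` [set t]) f.
Proof.
move=> dD [c /(spk_bounded dD)[fc|[t [Dt tf]]]].
  by left; exists c; apply/eqP; rewrite -subr_eq0 fc.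
by right; exists t; split=> //; exists c.
Qed.

Definition nsum N S : set V := [set f | exists n a, [/\ N n, S a & f = n + a]].

Lemma nsum_specker S N S' : specker S -> spideal S N -> specker S' -> S' `<=` S ->
  specker (nsum N S').
Proof.
move=> sS [NS N0 ND Nsupp] [S'0 S'D S'phi] S'S; have [_ SD Sphi] := sS.
have [_ SB] := specker_subgroup sS; split.
- by exists 0, 0; rewrite addr0.
- move=> _ _ [n [a [Nn Sa ->]]] [k [b [Nk Sb ->]]]; exists (n + k), (a + b).
  by rewrite addrACA; split=> //; [exact: ND|exact: S'D].
- move=> phi _ p0 [n [a [Nn Sa ->]]].
  (* The difference vanishes wherever [n] does, so support closure puts it in [N]. *)
  exists ((phi \o (n + a)) - (phi \o a)), (phi \o a); rewrite subrK; split=> //.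
    apply: (Nsupp n) => //.
      by apply: SB; apply: (Sphi) => //; [apply: SD; [exact: NS|exact: S'S]|exact: S'S].
    by move=> x nx; rewrite !fctE /= nx add0r subrr.
  exact: S'phi.
Qed.

(** If [N] contains a nonzero constant, its support is everything and the quotient is trivial;
    otherwise the quotient is infinite cyclic on [cst 1]. *)
Lemma freemod_constants S N : specker S -> S (cst 1) -> spideal S N ->
  freemod [set f | exists c, N (f - cst c)] N.
Proof.
move=> sS S1 idN; have [NS N0 ND Nsupp] := idN; have sN := spideal_subgroup sS idN.
have Scst c : S (cst c).
  rewrite (_ : cst c = fun x => c * cst 1 x); first exact: specker_scale.
  by apply/funext => x; rewrite /cst mulr1.
have cst1 (c : int) : (cst 1 : V) *~ c = cst c.
  have nat1 (k : nat) : (cst 1 : V) *+ k = cst k%:Z.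
    by elim: k => // k IH; rewrite mulrS IH; apply/funext => x; rewrite !fctE; lia.
  case: c => k; first exact: nat1.
  by rewrite NegzE mulrNz -[_ *~ _]/(_ *+ k.+1) nat1.
have [[c [c0 Nc]]|nc] := pselect (exists c : int, c <> 0 /\ N (cst c)).
  exists set0; split=> //.
    move=> P _ NP _ f [d Nd]; apply: NP; rewrite -(subrK (cst d) f); apply: ND => //.
    by apply: (Nsupp (cst c)) => // x /c0.
  by move=> [|b s] n _ sB _ b' //; case: (sB b); rewrite mem_head.
exists [set cst 1]; split.
- by move=> _ ->; exists 1; rewrite subrr.
- move=> P sP NP BP f [c Nc]; rewrite -(subrK (cst c) f); apply: subgroupD => //.
    exact: NP.
  by rewrite -cst1; apply: subgroupMz => //; exact: BP.
- move=> s n us sB Ns b bs; have b1 : b = cst 1 := sB _ bs.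
  have s1 : s = [:: b].
    case: s us sB bs {Ns} => [//|d [|d' s]]; first by rewrite inE => _ _ /eqP ->.
    rewrite /= inE negb_or => /andP[/andP[/eqP dd' _] _] sB _; case: dd'.
    transitivity (cst 1 : V); first by apply: sB; exact: mem_head.
    by symmetry; apply: sB; rewrite in_cons mem_head orbT.
  move: Ns; rewrite s1 /lcomb big_seq1 b1 cst1 => Nn.
  by apply: contrapT => n0; apply: nc; exists (n (cst 1)).
Qed.

(* Adjoining the idempotents one by one, the successive quotients are the groups
   [spk1 (below u)] modulo the [spideal] of all [b] with [e u * b] already present. *)
Lemma freemod_spk1_below t N : spideal (spk1 (below t)) N -> freemod (spk1 (below t)) N.
Proof.
elim/(well_founded_ind lt_wf): t N => t IH N idN.
have sS := spk1_specker e (below t); have S1 := spk1_cst e (below t) 1.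
have [NS N0 ND Nsupp] := idN; have sN := spideal_subgroup sS idN.
(* Every stage contains the constants, so the chain can only start at [N] plus the constants; what
   lies between is left to [freemod_constants]. *)
pose K : set V := [set f | exists c, N (f - cst c)].
have NK : N `<=` K by move=> f Nf; exists 0; rewrite subr0.
have sK : is_subgroup K.
  split; first exact: NK.
  move=> f g [c Nc] [d Nd]; exists (c - d).
  rewrite (_ : f - g - cst (c - d) = f - cst c - (g - cst d)); first exact: sN.2.
  by apply/funext => x; rewrite !fctE; lia.
apply: (@freemod_trans _ _ K) => //; last exact: (freemod_constants sS).
  move=> f [c /NS fc]; rewrite -(subrK (cst c) f); apply: spk1_add => //.
  exact: spk1_cst.
have sub u : lt u t -> below u `|` [set u] `<=` below t.
  by move=> ut; apply: below_succ_sub => //; exact: below_down_closed.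
have sub' u : lt u t -> below u `<=` below t.
  by move=> ut r ru; apply: (sub _ ut); left.
have sL u : lt u t -> specker (nsum N (spk1 (below u))).
  move=> ut; apply: (nsum_specker sS) => //; first exact: spk1_specker.
  by apply: spk1S; exact: sub'.
have KL u : lt u t -> K `<=` nsum N (spk1 (below u)).
  move=> ut f [c Nc]; exists (f - cst c), (cst c); rewrite subrK; split=> //.
  exact: spk1_cst.
have nadj u f : lt u t -> spk1 (below u `|` [set u]) f ->
    adjoin e u (nsum N (spk1 (below u))) (spk1 (below u)) f.
  move=> ut /(spk1_adjoin e01)[a [b [Ba Bb ->]]]; exists a, b; split=> //.
  by exists 0, a; rewrite add0r.
have adjn u f n : lt u t -> N n -> adjoin e u (nsum N (spk1 (below u))) (spk1 (below u)) f ->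
    adjoin e u (nsum N (spk1 (below u))) (spk1 (below u)) (n + f).
  move=> ut Nn [_ [b [[k [a [Nk Ba ->]]] Bb ->]]].
  exists (n + k + a), b; split=> //; last by rewrite !addrA.
  by exists (n + k), a; split=> //; exact: ND.
apply: (@freemod_chain _ W lt (below t) (fun u => nsum N (spk1 (below u)))
  (fun u => adjoin e u (nsum N (spk1 (below u))) (spk1 (below u)))) => //.
- by move=> u ut; exact/specker_subgroup/sL.
- move=> u ut _ [_ [b [[n [a [Nn Ba ->]]] Bb ->]]].
  rewrite -addrA; apply: spk1_add; first exact: NS.
  apply: (@adjoin_sub _ _ e (below u) u) => //.
    by move=> g gu; apply: spk_spk1; apply: spkS gu; exact: sub ut.
  by exists a, b; split=> //; apply: spk1S Ba; exact: sub'.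
- move=> u r ut rt ur _ [_ [b [[n [a [Nn Ba ->]]] Bb ->]]].
  rewrite -addrA; eexists n, _; split=> //.
  have sub2 : below u `|` [set u] `<=` below r.
    by apply: below_succ_sub => //; exact: below_down_closed.
  apply: (@adjoin_sub _ _ e (below u) u); first exact: spk1_specker.
    by move=> g gu; apply: spk_spk1; apply: spkS gu; exact: sub2.
  by exists a, b; split=> //; apply: spk1S Ba => q qu; apply: sub2; left.
- move=> f /(spk1_bounded (@below_down_closed t))[[c ->]|[u [ut uf]]].
    by left; exists c; rewrite subrr.
  by right; exists u => //; exact: nadj.
- move=> u _ ut [n [a [Nn Ba ->]]].
  have [[c ->]|[r [ru ra]]] := spk1_bounded (@below_down_closed u) Ba.
    by left; exists c; rewrite addrK.
  have rt := lt_trans ru ut; right; exists r; split=> //.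
  by apply: adjn => //; exact: nadj.
- move=> u ut; apply: (freemod_adjoin e01) => //; first exact: sL.
    by move=> f /spk_spk1 fu; exists 0, f; rewrite add0r.
  exact: IH.
Qed.

(** The chain runs over the indices outside [D0]; as [D0] is an initial segment, [spk D0] lies in
    every stage. *)
Lemma freemod_spk D0 : down_closed D0 -> freemod (spk setT) (spk D0).
Proof.
move=> dD0; have spk_zero D : spk D 0 by exact: spk0.
have adj u f : spk (below u `|` [set u]) f -> adjoin e u (spk (below u)) (spk1 (below u)) f.
  exact: spk_adjoin.
have case_below u f : spk (below u `|` [set u]) f ->
    spk D0 f \/ (~ D0 u /\ adjoin e u (spk (below u)) (spk1 (below u)) f).
  move=> uf; have [Du|nDu] := pselect (D0 u); last by right; split=> //; exact: adj.
  by left; apply: spkS uf; exact: below_succ_sub.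
apply: (@freemod_chain _ W lt (~` D0) (fun u => spk (below u))
  (fun u => adjoin e u (spk (below u)) (spk1 (below u)))) => //.
- by move=> u _; exact/specker_subgroup/spk_specker.
- move=> u nDu; apply: spkS => r Dr; have [//|[eru|ur]] := lt_total r u.
    by case: nDu; rewrite -eru.
  by case: nDu; exact: dD0 ur.
- move=> u _ _ [a [b [Ba Bb ->]]].
  apply: (@adjoin_sub _ _ e (below u) u); first exact: spk_specker.
    by apply: spkS.
  by exists a, b; split=> //; apply: spkS Ba.
- move=> u r _ _ ur _ [a [b [Ba Bb ->]]].
  have sub2 : below u `|` [set u] `<=` below r.
    by apply: below_succ_sub => //; exact: below_down_closed.
  apply: (@adjoin_sub _ _ e (below u) u); first exact: spk_specker.
    exact: spkS.
  by exists a, b; split=> //; apply: spkS Ba => q qu; apply: sub2; left.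
- move=> f /spk_bounded[//|->|[u [_ /case_below[|[nDu]]]]]; [by left|by left|].
  by right; exists u.
- move=> u f nDu /(spk_bounded (@below_down_closed u))[->|[r [ru /case_below[|[nDr]]]]].
  + by left.
  + by left.
  + by right; exists r.
- move=> u _; apply: (freemod_adjoin e01) => //; first exact: spk_specker.
  exact: freemod_spk1_below.
Qed.

End WellOrderedGenerators.

(** Membership in [B] is compared first and a given well-order second, which makes [B] an initial
    segment. *)
Lemma exists_well_order (W : Type) (B : set W) : exists lt : W -> W -> Prop,
  [/\ well_founded lt, forall u t, lt u t \/ u = t \/ lt t u,
      forall r u t, lt r u -> lt u t -> lt r t & forall u t, B t -> lt u t -> B u].
Proof.
have [r rP] := wochoice.well_ordering_principle {classic W}.
pose R (u t : W) : Prop := r u t.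
have minP (A : set W) : A !=set0 -> exists z, [/\ A z, forall y, A y -> R z y &
    forall z', A z' -> (forall y, A y -> R z' y) -> z = z'].
  move=> [x Ax]; have [|z [[Az zA] zu]] := rP (fun x : {classic W} => `[< A x >]).
    by exists x; apply/asboolP.
  exists z; split; first exact/asboolP.
    by move=> y Ay; apply: zA; apply/asboolP.
  move=> z' Az' z'P; apply: zu; split; first exact/asboolP.
  by move=> y /asboolP; exact: z'P.
(* The order axioms are read off from the unique minima of sets of two or three elements. *)
have Rtot u t : R u t \/ R t u.
  have [|z [[->|->] zA _]] := minP [set y | y = u \/ y = t]; first by exists u; left.
    by left; apply: zA; right.
  by right; apply: zA; left.
have Rrefl u : R u u by case: (Rtot u u).
have Ranti u t : R u t -> R t u -> u = t.
  move=> ut tu; have [|z [_ _ zu]] := minP [set y | y = u \/ y = t]; first by exists u; left.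
  have <- : z = u by apply: zu; [left|move=> y [->|->]].
  by apply: zu; [right|move=> y [->|->]].
have Rtrans a b c : R a b -> R b c -> R a c.
  move=> ab bc; have [|z [zz zA _]] := minP [set y | [\/ y = a, y = b | y = c]].
    by exists a; exact: Or31.
  case: zz zA => -> zA; first by apply: zA; exact: Or33.
    by rewrite (Ranti a b) //; apply: zA; exact: Or31.
  have <- : b = c by apply: Ranti => //; apply: zA; exact: Or32.
  by [].
pose lt u t := (B u /\ ~ B t) \/ [/\ (B u <-> B t), u <> t & R u t].
exists lt; split.
- have min (A : set W) : A !=set0 -> exists z, A z /\ forall y, A y -> ~ lt y z.
    move=> A0; have [AB0|nAB] := pselect (A `&` B !=set0).
      have [z [[Az Bz] zA _]] := minP _ AB0; exists z; split=> // y Ay [[_ /(_ Bz)//]|].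
      by move=> [BB yz Ryz]; apply: yz; apply: Ranti => //; apply: zA; split=> //; apply/BB.
    have [z [Az zA _]] := minP _ A0; exists z; split=> // y Ay [[By _]|].
      by apply: nAB; exists y.
    by move=> [_ yz Ryz]; apply: yz; apply: Ranti => //; exact: zA.
  move=> x; apply: contrapT => nx.
  have [|z [nz zmin]] := min [set x | ~ Acc lt x]; first by exists x.
  apply: nz; constructor => y yz; apply: contrapT => ny; exact: (zmin y).
- move=> u t; have [->|ut] := pselect (u = t); first by right; left.
  have [Bu|Bu] := pselect (B u); have [Bt|Bt] := pselect (B t).
  + by have [] := Rtot u t; [left; right|right; right; right; split=> //; exact: nesym].
  + by left; left.
  + by right; right; left.
  + by have [] := Rtot u t; [left; right|right; right; right; split=> //; exact: nesym].
- move=> a b c [[Ba nBb]|[ab nab Rab]] [[Bb nBc]|[bc nbc Rbc]].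
  + by [].
  + by left; split=> //; move=> /bc.
  + by left; split=> //; apply/ab.
  + right; split; first by rewrite ab.
      by move=> eac; apply: nab; apply: Ranti => //; rewrite eac.
    exact: Rtrans Rbc.
- by move=> u t Bt [[]//|[BB _ _]]; apply/BB.
Qed.

Theorem noebeling (X : Type) (A B : set (X -> int)) : specker A -> specker B -> B `<=` A ->
  (forall f, A f -> exists s : seq int, forall x, f x \in s) -> freemod A B.
Proof.
move=> sA sB BA Afin.
pose W := {f : X -> int | A f /\ forall x, f x = 0 \/ f x = 1}.
pose e (w : W) := sval w.
have e01 t x : e t x = 0 \/ e t x = 1 by case: (svalP t).
have spkE (C : set (X -> int)) : specker C -> C `<=` A ->
    spk e [set w | C (e w)] = C.
  move=> sC CA; apply/seteqP; split; first exact: spk_min.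
  move=> f Cf; have [s fs0] := Afin _ (CA _ Cf); have [C0 CD Cphi] := sC.
  (* [fs s] keeps the values of [f] listed in [s] and erases the others. Adding a new nonzero value
     [n] to the list adds [n] times the idempotent [chi]. *)
  pose fs (s : seq int) := ((fun z : int => if z \in s then z else 0) \o f : X -> int).
  have -> : f = fs s by apply/funext => x; rewrite /fs /= fs0.
  elim: s {fs0} => [|n s IH]; first by rewrite (_ : fs _ = 0); [exact: spk0|apply/funext].
  have [n0|n0] := eqVneq n 0.
    rewrite (_ : fs _ = fs s) //; apply/funext => x; rewrite /fs /= inE n0.
    by have [->|] := eqVneq (f x) 0; rewrite ?if_same.
  pose chi := (fun z : int => (z == n)%:Z) \o f.
  have Cchi : C chi by apply: Cphi => //; rewrite eq_sym (negPf n0).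
  have Wchi : A chi /\ forall x, chi x = 0 \/ chi x = 1.
    split; first exact: CA.
    by move=> x; rewrite /chi /=; case: eqP; [right|left].
  have spkchi : spk e [set w | C (e w)] chi.
    by rewrite -[chi]/(e (exist _ chi Wchi)); exact: spk_gen.
  have [ns|ns] := boolP (n \in s).
    rewrite (_ : fs _ = fs s) //; apply/funext => x; rewrite /fs /= inE.
    by have [->|//] := eqVneq (f x) n; rewrite ns.
  rewrite (_ : fs _ = fs s + ((fun z => n * z) \o chi)).
    by apply: spk_add => //; apply: spk_comp => //; rewrite mulr0.
  apply/funext => x; rewrite !fctE /fs /chi /= inE.
  by have [->|_] := eqVneq (f x) n; rewrite ?(negPf ns) ?mulr1 ?mulr0 ?add0r ?addr0.
have [lt [wf tot tr init]] := exists_well_order [set w | B (e w)].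
have := @freemod_spk X W e lt e01 wf tot tr [set w | B (e w)].
rewrite spkE // (_ : setT = [set w | A (e w)]); last first.
  by apply/seteqP; split=> // w _; case: (svalP w).
by rewrite spkE //; apply=> u t; exact: init.
Qed.

(** * Freeness of the groups of divisorial ideals *)

Lemma Cc_specker (X : topologicalType) : specker (@Cc X).
Proof.
split.
- apply/CcP; split; first exact: lcst_cst.
  by exists set0; split; [exact: compact0|exact: closed0|move=> x /eqP].
- by move=> f g cf cg; exact: (Cc_op2 (op := +%R)).
- by move=> phi f p0 cf; exact: Cc_op1.
Qed.

Lemma Cc_finite_range (X : topologicalType) (f : X -> int) : Cc f ->
  exists s : seq int, forall x, f x \in s.
Proof.
move=> /Cc_bounded[m fm]; exists [seq k%:Z - m%:Z | k <- iota 0 (m + m).+1] => x.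
apply/mapP; exists `|(f x + m%:Z)%R|%N; have := fm x; first by rewrite mem_iota; lia.
by lia.
Qed.

Lemma specker_set0 (X : Type) : specker [set (0 : X -> int)].
Proof.
split=> //= [_ _ -> ->|phi _ p0 ->]; first by rewrite addr0.
by apply/funext => x; exact: p0.
Qed.

Section DivisorGroup.
Variable R : idomainType.
Hypotheses (hSP : SP_domain R) (hnf : not_field R).
Variables (E : topologicalType) (j : E -> MaxT R).
Hypothesis hj : gleason_cover j.
Local Notation K := {fraction R}.
Local Notation beta := (beta j).
Local Notation inv := (colon (@Rset R)).
Local Notation zpow := (zpow (@dstar R) (@Rset R) inv).
Local Notation comb := (comb (@dstar R) (@Rset R) inv).
Implicit Types D : set K.

Lemma divisorial_Rset : divisorial (@Rset R).
Proof. exact/invertible_divisorial/invertible_Rset. Qed.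

Lemma beta_Rset : beta (@Rset R) = 0.
Proof.
rewrite (beta_invertible hSP hnf hj) //; last exact: invertible_Rset.
by apply/funext => e; exact: nu_Rset.
Qed.

Lemma beta_iter_dstar D k : divisorial D ->
  divisorial (iter k (dstar D) (@Rset R)) /\
  beta (iter k (dstar D) (@Rset R)) = beta D *+ k.
Proof.
move=> dD; elim: k => [|k [dI IH]] /=.
  by split; [exact: divisorial_Rset|rewrite beta_Rset].
split; first exact: divisorial_dstar.
by rewrite (beta_dstar hSP hnf hj) // IH mulrS.
Qed.

Lemma beta_zpow D n : divisorial D ->
  divisorial (zpow D n) /\ beta (zpow D n) = beta D *~ n.
Proof.
move=> dD; case: n => k; first exact: beta_iter_dstar.
have dI : divisorial (inv D) by apply: divisorial_inv => //; exact: divisorial_frac.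
have [dk bk] := beta_iter_dstar k.+1 dI; split=> //.
rewrite -[zpow D _]/(iter k.+1 (dstar (inv D)) (@Rset R)) bk (beta_inv hSP hnf hj) //.
by rewrite NegzE mulrNz -[_ *~ _]/(_ *+ k.+1) -mulNrn.
Qed.

Lemma beta_comb bs ns : (forall b, List.In b bs -> divisorial b) ->
  divisorial (comb bs ns) /\
  beta (comb bs ns) = \sum_(p <- zip bs ns) beta p.1 *~ p.2.
Proof.
rewrite /comb; elim: bs ns => [|b bs IH] [|n ns] dbs /=;
  try by rewrite big_nil; split; [exact: divisorial_Rset|exact: beta_Rset].
have [dn bn] := beta_zpow n (dbs b (or_introl erefl)).
have [dc bc] := IH ns (fun c cb => dbs c (or_intror cb)).
split; first exact: divisorial_dstar.
by rewrite (beta_dstar hSP hnf hj) // big_cons /= bn bc.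
Qed.

(** Coefficients given by position become a function of the basis element: injectivity of [beta]
    keeps the images distinct. *)
Lemma lcomb_zip bs ns : List.NoDup bs -> size ns = size bs ->
  (forall b, List.In b bs -> divisorial b) ->
  exists n : (E -> int) -> int, [/\ uniq [seq beta b | b <- bs],
    lcomb [seq beta b | b <- bs] n = \sum_(p <- zip bs ns) beta p.1 *~ p.2,
    forall v, v \in [seq beta b | b <- bs] -> exists b, List.In b bs /\ beta b = v &
    forall k, List.In k ns -> exists2 v, v \in [seq beta b | b <- bs] & n v = k].
Proof.
elim: bs ns => [|b bs IH] [|k ns] //= nd sz dbs.
  by exists (fun=> 0); split=> //; rewrite /lcomb !big_nil.
have [nb nd'] := (List.NoDup_cons_iff b bs).1 nd; case: sz => sz.
have [n [us en mem nP]] := IH ns nd' sz (fun c cb => dbs c (or_intror cb)).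
have nbb : beta b \notin [seq beta b | b <- bs].
  apply/negP => /mem[c [cb ec]]; apply: nb.
  rewrite -(beta_inj hSP hnf hj _ _ ec) //; first by apply: dbs; right.
  by apply: dbs; left.
exists (fun v => if v == beta b then k else n v); split.
- by rewrite nbb.
- rewrite [RHS]big_cons -en /lcomb big_cons eqxx /=; congr (_ + _).
  rewrite big_seq [RHS]big_seq; apply: eq_bigr => v vb.
  by rewrite (_ : v == beta b = false) //; apply: contraNF nbb => /eqP <-.
- move=> v; rewrite inE => /orP[/eqP ->|/mem[c [cb cv]]]; first by exists b; split; [left|].
  by exists c; split; [right|].
- move=> i [<-|/nP[v vb vi]]; first by exists (beta b); rewrite ?mem_head ?eqxx.
  exists v; first by rewrite inE vb orbT.
  by rewrite (_ : v == beta b = false) //; apply: contraNF nbb => /eqP <-.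
Qed.

Lemma free_abelian_mod_divisorial (H : set (set K)) (H' : set (E -> int)) :
  is_subgroup H' -> H' `<=` @Cc E ->
  (forall D, H D -> divisorial D) -> (forall D, divisorial D -> (H D <-> H' (beta D))) ->
  freemod (@Cc E) H' ->
  free_abelian_mod (@dstar R) (@Rset R) inv (@divisorial R) H.
Proof.
move=> sH' H'C Hdiv HH' [B' [B'C gen ind]].
exists [set D | divisorial D /\ B' (beta D)]; split; first by move=> D [].
have lift g : Cc g -> exists D, divisorial D /\ beta D = g by exact: beta_surj.
split; last first.
  move=> bs ns nd sz bsB Hc k kns.
  have dbs b : List.In b bs -> divisorial b by move=> /bsB[].
  have [n [us en mem nP]] := lcomb_zip nd sz dbs.
  have [dc bc] := beta_comb ns dbs; have [v vb <-] := nP _ kns.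
  apply: (ind _ n us _ _ v vb); first by move=> _ /mem[b [/bsB[_ Bb] <-]].
  by rewrite en -bc; apply/HH'.
(* Generation is tested on the subgroup of functions having an explicit expression, which then
   yields the lists to be lifted. *)
pose P : set (E -> int) := [set g | exists h l, [/\ H' h,
  forall p, List.In p l -> divisorial p.1 /\ B' (beta p.1) &
  g = h + \sum_(p <- l) beta p.1 *~ p.2]].
have sP : is_subgroup P.
  split; first by exists 0, [::]; rewrite big_nil addr0; split=> //; case: sH'.
  move=> _ _ [h [l [Hh lP ->]]] [h' [l' [Hh' l'P ->]]].
  exists (h - h'), (l ++ [seq (p.1, - p.2) | p <- l']); split.
  - exact: sH'.2.
  - move=> p pl; have [/lP//|pl'] := List.in_app_or _ _ _ pl.
    elim: l' l'P pl' {pl} => //= q l' IH l'P [<-|pl'] /=; first by apply: l'P; left.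
    by apply: IH pl' => r rl; apply: l'P; right.
  - rewrite big_cat big_map /= opprD addrACA; congr (_ + (_ + _)).
    by rewrite -sumrN; apply: eq_bigr => p _; rewrite mulrNz.
move=> D dD; have : P (beta D).
  apply: (gen P) (beta_Cc hSP hnf hj dD) => //.
    by move=> h Hh; exists h, [::]; rewrite big_nil addr0.
  move=> b Bb; have [D' [dD' eD']] := lift _ (B'C _ Bb); exists 0, [:: (D', 1)].
  rewrite big_seq1 /= add0r mulr1z eD'; split=> //; first by case: sH'.
  by move=> p [<-|[]]; rewrite /= eD'.
move=> [h [l [Hh lP eD]]]; have [Dh [dDh eDh]] := lift _ (H'C _ Hh).
have lP' b : List.In b (unzip1 l) -> divisorial b /\ B' (beta b).
  elim: l lP {eD} => //= p l IH lP [<-|bl]; first by apply: lP; left.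
  by apply: IH bl => q ql; apply: lP; right.
have [dc bc] := beta_comb (unzip2 l) (fun b bl => (lP' b bl).1).
exists (unzip1 l), (unzip2 l), Dh; split=> //; first by apply/HH'; rewrite ?eDh.
apply: (beta_inj hSP hnf hj) => //; first exact: divisorial_dstar.
by rewrite (beta_dstar hSP hnf hj) // bc zip_unzip eDh eD.
Qed.

Lemma free_abelian_divisorial :
  free_abelian (@dstar R) (@Rset R) inv (@divisorial R).
Proof.
apply: (@free_abelian_mod_divisorial _ [set 0]).
- exact/specker_subgroup/specker_set0.
- by move=> _ ->; case: (Cc_specker E).
- by move=> _ ->; exact: divisorial_Rset.
- move=> D dD; split=> [->|]; first exact: beta_Rset.
  rewrite /= -beta_Rset; apply: (beta_inj hSP hnf hj) => //; exact: divisorial_Rset.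
- apply: noebeling; [exact: Cc_specker|exact: specker_set0| |exact: Cc_finite_range].
  by move=> _ ->; case: (Cc_specker E).
Qed.

(** Left composition commutes with pullback along [j], so the pulled-back functions form a group to
    which the relative theorem applies. *)
Lemma free_abelian_mod_invertible :
  free_abelian_mod (@dstar R) (@Rset R) inv (@divisorial R) (@invertible R).
Proof.
pose H' : set (E -> int) := [set f \o j | f in @Cc (MaxT R)].
have [C0 CD Cphi] := Cc_specker (MaxT R).
have sH' : specker H'.
  split.
  - by exists 0.
  - by move=> _ _ [f cf <-] [g cg <-]; exists (f + g) => //; exact: CD.
  - by move=> phi _ p0 [f cf <-]; exists (phi \o f) => //; exact: Cphi.
have H'C : H' `<=` @Cc E.
  move=> _ [f /(Cc_invertible hSP hnf)[I [iI <-]] <-].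
  rewrite -(beta_invertible hSP hnf hj) //; apply: beta_Cc => //.
  exact: invertible_divisorial.
apply: (@free_abelian_mod_divisorial _ H') => //.
- exact: specker_subgroup.
- exact: invertible_divisorial.
- move=> D dD; split=> [iD|[f /(Cc_invertible hSP hnf)[I [iI <-]]]].
    by rewrite (beta_invertible hSP hnf hj) //; exists (nuM D) => //; exact: invertible_Cc.
  rewrite -(beta_invertible hSP hnf hj) // => eI.
  by rewrite -(beta_inj hSP hnf hj _ _ eI) //; exact: invertible_divisorial.
- by apply: noebeling => //; [exact: Cc_specker|exact: Cc_finite_range].
Qed.

End DivisorGroup.

Theorem theorem6p2 (R : idomainType) (E : topologicalType) (j : E -> MaxT R)
  (hSP : SP_domain R) (hnf : not_field R) (hj : gleason_cover j) :
  (* Psi : Inv(R) -> C_c(M,Z), I |-> nu_I, is a group isomorphism *)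
  [/\ (forall I : set {fraction R}, invertible I -> Cc (nuM I)),
      (forall I J : set {fraction R}, invertible I -> invertible J ->
          nuM (iprod I J) = (fun M => nuM I M + nuM J M)),
      (forall I J : set {fraction R}, invertible I -> invertible J -> nuM I = nuM J -> I = J) &
      (forall f : MaxT R -> int, Cc f -> exists I, invertible I /\ nuM I = f)] /\
      (* beta : Div(R) -> C_c(E,Z) isomorphism with beta|Inv = psi o Psi *)
      (exists beta : set {fraction R} -> (E -> int),
         [/\ (forall D : set {fraction R}, divisorial D -> Cc (beta D)),
             (forall D1 D2 : set {fraction R}, divisorial D1 -> divisorial D2 ->
                 beta (dstar D1 D2) = (fun x => beta D1 x + beta D2 x)),
             (forall D1 D2 : set {fraction R}, divisorial D1 -> divisorial D2 ->
                 beta D1 = beta D2 -> D1 = D2),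
             (forall g : E -> int, Cc g -> exists D, divisorial D /\ beta D = g) &
             (forall I : set {fraction R}, invertible I -> beta I = nuM I \o j)]) /\
      (* Div(R) is free abelian *)
      free_abelian (@dstar R) (@Rset R) (colon (@Rset R)) (@divisorial R) /\
      (* Div(R)/Inv(R) is free abelian *)
      free_abelian_mod (@dstar R) (@Rset R) (colon (@Rset R))
        (@divisorial R) (@invertible R).
Proof.
split; last split; last split.
- split.
  + by move=> I iI; exact: invertible_Cc.
  + by move=> I J [fI _] [fJ _]; exact: nu_iprod.
  + by move=> I J [fI _] [fJ _]; exact: nu_inj.
  + by move=> f cf; exact: Cc_invertible.
- exists (beta j); split.
  + by move=> D dD; exact: beta_Cc.
  + by move=> D D' dD dD'; exact: beta_dstar.
  + by move=> D D' dD dD'; exact: (beta_inj hSP hnf hj).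
  + by move=> g cg; exact: beta_surj.
  + by move=> I iI; exact: beta_invertible.
- exact: (free_abelian_divisorial hSP hnf hj).
- exact: (free_abelian_mod_invertible hSP hnf hj).
Qed.
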